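(* Let $(\mathfrak{g},\nabla,\delta)$ be an involutive Lie bialgebra over $\mathbb{Q}$, let $M$ be a (left) $\mathfrak{g}$-module, and let $\mu:M\to M\otimes\mathfrak{g}$ be a $\mathbb{Q}$-linear map. Let $\partial=\partial^M:M\otimes\Lambda^p\mathfrak{g}\to M\otimes\Lambda^{p-1}\mathfrak{g}$ be the boundary operator of the standard chain complex of $\mathfrak{g}$ with values in $M$, and let $d=d^M:M\otimes\Lambda^p\mathfrak{g}\to M\otimes\Lambda^{p+1}\mathfrak{g}$ $(p\geq 0)$ be the natural extension of $\mu$. Then the pair $(M,\mu)$ is an involutive $\mathfrak{g}$-bimodule if and only if $dd=0$ and $d\partial+\partial d=0$ on $M\otimes\Lambda^*\mathfrak{g}$.
   Context: All vector spaces are over $\mathbb{Q}$. For a vector space $V$, $\Lambda^pV\subset V^{\otimes p}$ is the subspace of antisymmetric tensors, $X_1\wedge\cdots\wedge X_p:=\sum_{s\in\mathfrak{S}_p}(\operatorname{sgn}s)\,X_{s(1)}\otimes\cdots\otimes X_{s(p)}$, and the wedge product is the bilinear map with $(X_1\wedge\cdots\wedge X_p)\wedge(X_{p+1}\wedge\cdots\wedge X_{p+q})=X_1\wedge\cdots\wedge X_{p+q}$; in particular $X\wedge Y=X\otimes Y-Y\otimes X$. For $u=m\otimes\xi\in M\otimes\Lambda^p\mathfrak{g}$ and $\eta\in\Lambda^q\mathfrak{g}$, $u\wedge\eta:=m\otimes(\xi\wedge\eta)$. $T$ is the flip on $\mathfrak{g}^{\otimes2}$ and $N:=1+(123)+(123)^2$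 acts on $\mathfrak{g}^{\otimes3}$. Hats over elements denote omission. On $\Lambda^*\mathfrak{g}$, with $[X,Y]=\nabla(X\otimes Y)$: $\sigma(Y)(X_1\wedge\cdots\wedge X_p):=\sum_{i}X_1\wedge\cdots\wedge[Y,X_i]\wedge\cdots\wedge X_p$; $\partial(X_1\wedge\cdots\wedge X_p):=\sum_{i<j}(-1)^{i+j}[X_i,X_j]\wedge X_1\wedge\cdots\widehat{X_i}\cdots\widehat{X_j}\cdots\wedge X_p$; $d|_{\Lambda^0\mathfrak{g}}:=0$ and $d(X_1\wedge\cdots\wedge X_p):=\sum_{i}(-1)^i(\delta X_i)\wedge X_1\wedge\cdots\widehat{X_i}\cdots\wedge X_p$, so $dX=-\delta X$ for $X\in\mathfrak{g}$. An involutive Lie bialgebra is a Lie algebra $(\mathfrak{g},\nabla)$ with a linear map $\delta:\mathfrak{g}\to\Lambda^2\mathfrak{g}$ satisfying the coJacobi identity $N(\delta\otimes1)\delta=0$, the compatibility $\delta[X,Y]=\sigma(X)(\delta Y)-\sigma(Y)(\delta X)$ for all $X,Y\in\mathfrak{g}$, and involutivity $\nabla\delta=0$. With coefficients in $M$ (action $X\otimes m\mapsto Xm$): $\overline{\sigma}:M\otimes\mathfrak{g}\to M$, $\overline{\sigma}(m\otimes X):=-Xm$; $\sigma(Y)(m\otimes\xi):=(Ym)\otimes\xi+m\otimes\sigma(Y)(\xi)$; $\Gamma(m\otimes X_1\wedge\cdots\wedge X_p):=\sum_{i=1}^p(-1)^i(X_im)\otimes X_1\wedge\cdots\widehat{X_i}\cdots\wedge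 X_p$; $\partial^M(m\otimes\xi):=\Gamma(m\otimes\xi)+m\otimes\partial\xi$ (zero on $M\otimes\Lambda^0\mathfrak{g}$); $d^M(m\otimes\xi):=\mu(m)\wedge\xi+m\otimes d\xi$, so that $d^M=\mu$ on $M=M\otimes\Lambda^0\mathfrak{g}$. $(M,\mu)$ is a right $\mathfrak{g}$-comodule if $(1_M\otimes\delta)\mu=(1_M\otimes(1-T))(\mu\otimes1_{\mathfrak{g}})\mu:M\to M\otimes\mathfrak{g}\otimes\mathfrak{g}$. It is a (right) $\mathfrak{g}$-bimodule if it is a right $\mathfrak{g}$-comodule and the compatibility condition $\sigma(Y)(\mu(m))-\mu(Ym)-(\overline{\sigma}\otimes1_{\mathfrak{g}})(1_M\otimes\delta)(m\otimes Y)=0$ holds for all $m\in M$, $Y\in\mathfrak{g}$. It is involutive if moreover $\overline{\sigma}\mu=0:M\to M$. *)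

(* Defs.v *)
From HB Require Import structures.
From mathcomp Require Import all_boot all_order all_fingroup all_algebra.
From mathcomp Require Import generic_quotient boolp zify.

Set Implicit Arguments.
Unset Strict Implicit.
Unset Printing Implicit Defensive.

Import GRing.Theory.
Local Open Scope ring_scope.
Local Open Scope quotient_scope.

Definition bilin (V W U : lmodType rat) (f : V -> W -> U) : Prop :=
  (forall w, linear (f^~ w)) /\ (forall v, linear (f v)).

Section BilinTheory.
Variables (V W U : lmodType rat) (f : V -> W -> U).
Hypothesis fB : bilin f.

Lemma bilinDl v v' w : f (v + v') w = f v w + f v' w.
Proof. by have := fB.1 w 1 v v'; rewrite !scale1r. Qed.

Lemma bilinDr v w w' : f v (w + w') = f v w + f v w'.
Proof. by have := fB.2 v 1 w w'; rewrite !scale1r. Qed.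

Lemma bilin0l w : f 0 w = 0.
Proof. by apply: (@addIr _ (f 0 w)); rewrite -bilinDl !add0r. Qed.

Lemma bilin0r v : f v 0 = 0.
Proof. by apply: (@addIr _ (f v 0)); rewrite -bilinDr !add0r. Qed.

Lemma bilinZl a v w : f (a *: v) w = a *: f v w.
Proof. by have := fB.1 w a v 0; rewrite !addr0 bilin0l addr0. Qed.

Lemma bilinZr a v w : f v (a *: w) = a *: f v w.
Proof. by have := fB.2 v a w 0; rewrite !addr0 bilin0r addr0. Qed.
End BilinTheory.

(** The tensor product of two rational vector spaces. A list
    [:: (v_1, w_1); ...; (v_n, w_n)] stands for the sum of the v_k (x) w_k, and
    two lists are identified when every bilinear map takes the same value on
    them. The universal property is [lift_tens], [lift_linear] and [tens_ext]. *)
Section Tensor.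
Variables V W : lmodType rat.

Definition bsum (U : lmodType rat) (f : V -> W -> U) (s : seq (V * W)) : U :=
  \sum_(x <- s) f x.1 x.2.

Definition tens_rel (s t : seq (V * W)) : bool :=
  `[< forall (U : lmodType rat) (f : V -> W -> U),
        bilin f -> bsum f s = bsum f t >].

Lemma tens_rel_refl : reflexive tens_rel.
Proof. by move=> s; apply/asboolP. Qed.

Lemma tens_rel_sym : symmetric tens_rel.
Proof.
by move=> s t; apply/asboolP/asboolP => h U f fB; rewrite (h U f fB).
Qed.

Lemma tens_rel_trans : transitive tens_rel.
Proof.
move=> s t u /asboolP h1 /asboolP h2; apply/asboolP => U f fB.
by rewrite (h1 U f fB) (h2 U f fB).
Qed.

Canonical tens_rel_equiv := EquivRel tens_rel tens_rel_refl tens_rel_sym tens_rel_trans.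

Definition tensor : Type := {eq_quot tens_rel}.
HB.instance Definition _ := Choice.on tensor.
HB.instance Definition _ := EqQuotient.on tensor.

Definition tpi (s : seq (V * W)) : tensor := \pi_tensor s.

Lemma tpiP s t : tpi s = tpi t <->
  forall (U : lmodType rat) (f : V -> W -> U), bilin f -> bsum f s = bsum f t.
Proof. by split=> [/eqquotP/asboolP | h]; last exact/eqquotP/asboolP. Qed.

Lemma tpiK (t : tensor) : tpi (repr t) = t.
Proof. exact: reprK. Qed.

Lemma bsum_repr s (U : lmodType rat) (f : V -> W -> U) :
  bilin f -> bsum f (repr (tpi s)) = bsum f s.
Proof. by move=> fB; apply: (tpiP _ _).1 => //; rewrite tpiK. Qed.

Lemma bsum_cat (U : lmodType rat) (f : V -> W -> U) s t :
  bsum f (s ++ t) = bsum f s + bsum f t.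
Proof. exact: big_cat. Qed.

Definition sclist (a : rat) (s : seq (V * W)) := [seq (a *: x.1, x.2) | x <- s].

Lemma bsum_scale (U : lmodType rat) (f : V -> W -> U) a s : bilin f ->
  bsum f (sclist a s) = a *: bsum f s.
Proof.
move=> fB; rewrite /bsum big_map scaler_sumr.
by apply: eq_bigr => x _ /=; rewrite (bilinZl fB).
Qed.

Definition tens_zero : tensor := tpi [::].
Definition tens_add (s t : tensor) : tensor := tpi (repr s ++ repr t).
Definition tens_scale (a : rat) (s : tensor) : tensor := tpi (sclist a (repr s)).
Definition tens_opp (s : tensor) : tensor := tens_scale (-1) s.

Lemma tens_addE s t : tens_add (tpi s) (tpi t) = tpi (s ++ t).
Proof. by apply/tpiP => U f fB; rewrite !bsum_cat !bsum_repr. Qed.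

Lemma tens_scaleE a s : tens_scale a (tpi s) = tpi (sclist a s).
Proof. by apply/tpiP => U f fB; rewrite !bsum_scale ?bsum_repr. Qed.

Lemma tens_addA : associative tens_add.
Proof.
by move=> s t u; rewrite -(tpiK s) -(tpiK t) -(tpiK u) !tens_addE catA.
Qed.

Lemma tens_addC : commutative tens_add.
Proof.
move=> s t; rewrite -(tpiK s) -(tpiK t) !tens_addE; apply/tpiP => U f fB.
by rewrite !bsum_cat addrC.
Qed.

Lemma tens_add0 : left_id tens_zero tens_add.
Proof. by move=> s; rewrite -(tpiK s) tens_addE. Qed.

Lemma tens_addN : left_inverse tens_zero tens_opp tens_add.
Proof.
move=> s; rewrite -(tpiK s) /tens_opp tens_scaleE tens_addE.
apply/tpiP => U f fB; rewrite bsum_cat bsum_scale // scaleN1r addNr.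
by rewrite /bsum big_nil.
Qed.

HB.instance Definition _ :=
  GRing.isZmodule.Build tensor tens_addA tens_addC tens_add0 tens_addN.

Lemma tens_scaleA a b s : tens_scale a (tens_scale b s) = tens_scale (a * b) s.
Proof.
rewrite -(tpiK s) !tens_scaleE; apply/tpiP => U f fB.
by rewrite !bsum_scale // scalerA.
Qed.

Lemma tens_scale1 : left_id 1 tens_scale.
Proof.
move=> s; rewrite -(tpiK s) !tens_scaleE; apply/tpiP => U f fB.
by rewrite !bsum_scale // scale1r.
Qed.

Lemma tens_scaleDr : right_distributive tens_scale +%R.
Proof.
move=> a s t; rewrite -(tpiK s) -(tpiK t) [_ + _]tens_addE !tens_scaleE.
rewrite [RHS]tens_addE; apply/tpiP => U f fB.
by rewrite bsum_cat !bsum_scale // bsum_cat scalerDr.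
Qed.

Lemma tens_scaleDl s : {morph tens_scale^~ s : a b / a + b}.
Proof.
move=> a b; rewrite -(tpiK s) /= !tens_scaleE.
rewrite [RHS]tens_addE; apply/tpiP => U f fB.
by rewrite bsum_cat !bsum_scale // scalerDl.
Qed.

HB.instance Definition _ := GRing.Zmodule_isLmodule.Build rat tensor
  tens_scaleA tens_scale1 tens_scaleDr tens_scaleDl.

Lemma tpiD s t : tpi s + tpi t = tpi (s ++ t).
Proof. exact: tens_addE. Qed.

Lemma tpiZ a s : a *: tpi s = tpi (sclist a s).
Proof. exact: tens_scaleE. Qed.

Definition tens (v : V) (w : W) : tensor := tpi [:: (v, w)].

Lemma tens_bilin : bilin tens.
Proof.
split=> [w a v v'|v a w w']; rewrite /tens tpiZ tpiD;
  apply/tpiP => U f fB;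
  rewrite bsum_cat bsum_scale // /bsum !big_seq1 /=.
  exact: fB.1.
exact: fB.2.
Qed.

Lemma tpi_sum s : tpi s = \sum_(x <- s) tens x.1 x.2.
Proof.
elim: s => [|x s IH]; first by rewrite big_nil.
by rewrite big_cons -IH tpiD /= -surjective_pairing.
Qed.

Lemma tensE (t : tensor) : t = \sum_(x <- repr t) tens x.1 x.2.
Proof. by rewrite -tpi_sum tpiK. Qed.

Lemma tens_ext (U : lmodType rat) (h k : {linear tensor -> U}) :
  (forall v w, h (tens v w) = k (tens v w)) -> h =1 k.
Proof.
by move=> hk t; rewrite (tensE t) !linear_sum; apply: eq_bigr => x _.
Qed.

(** For bilinear f, [lift f] is the linear map with v (x) w |-> f v w. *)
Definition lift (U : lmodType rat) (f : V -> W -> U) (t : tensor) : U :=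
  bsum f (repr t).

Lemma lift_tens (U : lmodType rat) (f : V -> W -> U) v w :
  bilin f -> lift f (tens v w) = f v w.
Proof. by move=> fB; rewrite /lift bsum_repr // /bsum big_seq1. Qed.

Lemma lift_linear (U : lmodType rat) (f : V -> W -> U) :
  bilin f -> linear (lift f).
Proof.
move=> fB a s t; rewrite -(tpiK s) -(tpiK t).
rewrite tpiZ tpiD /lift !bsum_repr //.
by rewrite bsum_cat bsum_scale.
Qed.

End Tensor.

Arguments tensor (V W)%_type_scope.
Notation "V ⊗ W" := (tensor V W) (at level 40, left associativity) : type_scope.
Notation "v ⊗ w" := (tens v w) (at level 40, left associativity) : ring_scope.

Section LinearPred.
Variables (U W : lmodType rat) (h : U -> W).
Hypothesis hL : linear h.

Lemma linD u v : h (u + v) = h u + h v.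
Proof. by have := hL 1 u v; rewrite !scale1r. Qed.

Lemma lin0 : h 0 = 0.
Proof. by apply: (@addIr _ (h 0)); rewrite -linD !add0r. Qed.

Lemma linZ a u : h (a *: u) = a *: h u.
Proof. by have := hL a u 0; rewrite !addr0 lin0 addr0. Qed.

Lemma lin_sum (I : Type) (r : seq I) (P : pred I) (F : I -> U) :
  h (\sum_(i <- r | P i) F i) = \sum_(i <- r | P i) h (F i).
Proof. by apply: big_morph; [exact: linD | exact: lin0]. Qed.
End LinearPred.

Lemma linear_id (U : lmodType rat) : linear (@id U).
Proof. by []. Qed.

Lemma linear_comp (U V W : lmodType rat) (h : V -> W) (k : U -> V) :
  linear h -> linear k -> linear (fun x => h (k x)).
Proof. by move=> hL kL a u v; rewrite kL hL. Qed.

Lemma linear_add (U V : lmodType rat) (h k : U -> V) :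
  linear h -> linear k -> linear (fun x => h x + k x).
Proof. by move=> hL kL a u v; rewrite kL hL scalerDr addrACA. Qed.

Lemma linear_scale (U V : lmodType rat) (h : U -> V) b :
  linear h -> linear (fun x => b *: h x).
Proof. by move=> hL a u v; rewrite hL scalerDr !scalerA mulrC. Qed.

Lemma linear_sumf (U V : lmodType rat) (I : Type) (r : seq I) (P : pred I)
    (h : I -> U -> V) :
  (forall i, linear (h i)) -> linear (fun x => \sum_(i <- r | P i) h i x).
Proof.
move=> hL a u v; rewrite scaler_sumr -big_split /=.
by apply: eq_bigr => i _; rewrite hL.
Qed.

Lemma linear_zero (U V : lmodType rat) : linear (fun _ : U => 0 : V).
Proof. by move=> a u v; rewrite scaler0 addr0. Qed.

Lemma tens_lext (V W U : lmodType rat) (h k : V ⊗ W -> U) :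
  linear h -> linear k -> (forall v w, h (v ⊗ w) = k (v ⊗ w)) -> h =1 k.
Proof.
move=> hL kL hk t; rewrite (tensE t) (lin_sum hL) (lin_sum kL).
by apply: eq_bigr.
Qed.

Definition tmap (V V' W W' : lmodType rat) (f : V -> V') (h : W -> W')
  : V ⊗ W -> V' ⊗ W' := lift (fun v w => f v ⊗ h w).

Lemma tmap_bilin (V V' W W' : lmodType rat) (f : V -> V') (h : W -> W') :
  linear f -> linear h -> bilin (fun v w => f v ⊗ h w).
Proof.
move=> fL hL; split=> [w|v] a x y.
  by rewrite fL (@tens_bilin V' W').1.
by rewrite hL (@tens_bilin V' W').2.
Qed.

Lemma tmap_tens (V V' W W' : lmodType rat) (f : V -> V') (h : W -> W') v w :
  linear f -> linear h -> tmap f h (v ⊗ w) = f v ⊗ h w.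
Proof. by move=> fL hL; rewrite /tmap lift_tens //; apply: tmap_bilin. Qed.

Lemma tmap_linear (V V' W W' : lmodType rat) (f : V -> V') (h : W -> W') :
  linear f -> linear h -> linear (tmap f h).
Proof. by move=> fL hL; apply/lift_linear/tmap_bilin. Qed.

Definition flip (V W : lmodType rat) : V ⊗ W -> W ⊗ V :=
  lift (fun v w => w ⊗ v).

Definition assocr (U V W : lmodType rat) : (U ⊗ V) ⊗ W -> U ⊗ (V ⊗ W) :=
  lift (fun t w => lift (fun u v => u ⊗ (v ⊗ w)) t).

Definition assocl (U V W : lmodType rat) : U ⊗ (V ⊗ W) -> (U ⊗ V) ⊗ W :=
  lift (fun u t => lift (fun v w => (u ⊗ v) ⊗ w) t).

Lemma flip_bilin (V W : lmodType rat) : bilin (fun (v : V) (w : W) => w ⊗ v).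
Proof. by have [l r] := @tens_bilin W V; split. Qed.

Lemma flip_tens (V W : lmodType rat) (v : V) (w : W) : flip (v ⊗ w) = w ⊗ v.
Proof. by rewrite /flip lift_tens //; apply: flip_bilin. Qed.

Lemma flip_linear (V W : lmodType rat) : linear (@flip V W).
Proof. exact/lift_linear/flip_bilin. Qed.

Lemma lift_combl (V W U : lmodType rat) a (f1 f2 : V -> W -> U) t :
  lift (fun v w => a *: f1 v w + f2 v w) t = a *: lift f1 t + lift f2 t.
Proof. by rewrite /lift /bsum big_split scaler_sumr. Qed.

Lemma eq_lift (V W U : lmodType rat) (f1 f2 : V -> W -> U) :
  f1 =2 f2 -> lift f1 =1 lift f2.
Proof. by move=> e t; apply: eq_bigr => x _; rewrite e. Qed.

Lemma assocr_bilin1 (U V W : lmodType rat) (w : W) :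
  bilin (fun (u : U) (v : V) => u ⊗ (v ⊗ w)).
Proof.
split=> [v|u] a x y; first by rewrite (@tens_bilin _ _).1.
by rewrite (@tens_bilin V W).1 (@tens_bilin _ _).2.
Qed.

Lemma assocr_bilin (U V W : lmodType rat) :
  bilin (fun t (w : W) => lift (fun (u : U) (v : V) => u ⊗ (v ⊗ w)) t).
Proof.
split=> [w|t] a x y; first exact/lift_linear/assocr_bilin1.
rewrite -lift_combl; apply: eq_lift => u v.
by rewrite (@tens_bilin V W).2 (@tens_bilin _ _).2.
Qed.

Lemma assocr_tens (U V W : lmodType rat) (u : U) (v : V) (w : W) :
  assocr ((u ⊗ v) ⊗ w) = u ⊗ (v ⊗ w).
Proof.
rewrite /assocr lift_tens; last exact: assocr_bilin.
by rewrite lift_tens //; apply: assocr_bilin1.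
Qed.

Lemma assocr_linear (U V W : lmodType rat) : linear (@assocr U V W).
Proof. exact/lift_linear/assocr_bilin. Qed.

Lemma assocl_bilin1 (U V W : lmodType rat) (u : U) :
  bilin (fun (v : V) (w : W) => (u ⊗ v) ⊗ w).
Proof.
split=> [w|v] a x y; last by rewrite (@tens_bilin _ _).2.
by rewrite (@tens_bilin U V).2 (@tens_bilin _ _).1.
Qed.

Lemma assocl_bilin (U V W : lmodType rat) :
  bilin (fun (u : U) t => lift (fun (v : V) (w : W) => (u ⊗ v) ⊗ w) t).
Proof.
split=> [t|u] a x y; last exact/lift_linear/assocl_bilin1.
rewrite -lift_combl; apply: eq_lift => v w.
by rewrite (@tens_bilin U V).1 (@tens_bilin _ _).1.
Qed.

Lemma assocl_tens (U V W : lmodType rat) (u : U) (v : V) (w : W) :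
  assocl (u ⊗ (v ⊗ w)) = (u ⊗ v) ⊗ w.
Proof.
rewrite /assocl lift_tens; last exact: assocl_bilin.
by rewrite lift_tens //; apply: assocl_bilin1.
Qed.

Lemma assocl_linear (U V W : lmodType rat) : linear (@assocl U V W).
Proof. exact/lift_linear/assocl_bilin. Qed.

Section Multilinear.
Variable V : lmodType rat.

Definition upd p (X : 'I_p -> V) (i : 'I_p) (v : V) : 'I_p -> V :=
  fun k => if k == i then v else X k.

Definition fcons p (v : V) (X : 'I_p -> V) : 'I_p.+1 -> V :=
  fun i => if unlift ord0 i is Some j then X j else v.

Definition fcat p q (X : 'I_p -> V) (Y : 'I_q -> V) : 'I_(p + q) -> V :=
  fun k => match split k with inl i => X i | inr j => Y j end.

(** X_1, ..., X_p with the entry of index i omitted *)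
Definition omit p (i : 'I_p.+1) (X : 'I_p.+1 -> V) : 'I_p -> V :=
  fun k => X (fintype.lift i k).

Definition multilinear p (U : lmodType rat) (f : ('I_p -> V) -> U) : Prop :=
  forall X i, linear (fun v => f (upd X i v)).

Definition skew p (U : lmodType rat) (f : ('I_p -> V) -> U) : Prop :=
  forall X (s : 'S_p), f (fun i => X (s i)) = (-1) ^+ s *: f X.

Fixpoint tpow (p : nat) : lmodType rat :=
  match p with
  | 0 => rat^o
  | p'.+1 => match p' with 0 => V | _.+1 => (V ⊗ tpow p')%type end
  end.

(** X_1 (x) ... (x) X_p *)
Fixpoint pure (p : nat) : ('I_p -> V) -> tpow p :=
  match p return ('I_p -> V) -> tpow p with
  | 0 => fun _ => (1 : rat)
  | p'.+1 =>
      match p' return (('I_p' -> V) -> tpow p') -> ('I_p'.+1 -> V) -> tpow p'.+1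
      with
      | 0 => fun _ X => X ord0
      | _.+1 => fun pure' X => X ord0 ⊗ pure' (omit ord0 X)
      end (@pure p')
  end.

(** For multilinear f, [mlift f] is the linear map with
    X_1 (x) ... (x) X_p |-> f X. *)
Fixpoint mlift (p : nat) (U : lmodType rat) : (('I_p -> V) -> U) -> tpow p -> U :=
  match p return (('I_p -> V) -> U) -> tpow p -> U with
  | 0 => fun f (a : rat) => a *: f (fun i => 0)
  | p'.+1 =>
      match p' return ((('I_p' -> V) -> U) -> tpow p' -> U) ->
                      (('I_p'.+1 -> V) -> U) -> tpow p'.+1 -> U
      with
      | 0 => fun _ f v => f (fun _ => v)
      | _.+1 => fun mlift' f => lift (fun v t => mlift' (fun X => f (fcons v X)) t)
      end (@mlift p' U)
  end.

Lemma multilinear_fcons p (U : lmodType rat) (f : ('I_p.+1 -> V) -> U) v :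
  multilinear f -> multilinear (fun X => f (fcons v X)).
Proof.
move=> fM X i.
suff e u : fcons v (upd X i u) = upd (fcons v X) (fintype.lift ord0 i) u.
  by move=> a u w; rewrite !e fM.
apply/funext => k; rewrite /fcons /upd.
case: (unliftP ord0 k) => [j ->|->]; last by [].
by rewrite (inj_eq lift_inj).
Qed.

Lemma multilinear_fcons0 p (U : lmodType rat) (f : ('I_p.+1 -> V) -> U) X :
  multilinear f -> linear (fun v => f (fcons v X)).
Proof.
move=> fM; suff e u : fcons u X = upd (fcons 0 X) ord0 u.
  by move=> a u w; rewrite (e u) (e w) (e (a *: u + w)) fM.
apply/funext => k; rewrite /fcons /upd.
by case: (unliftP ord0 k) => [j ->|->]; rewrite ?eqxx.
Qed.

Lemma fconsK p (X : 'I_p.+1 -> V) : fcons (X ord0) (omit ord0 X) = X.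
Proof.
by apply/funext => k; rewrite /fcons /omit; case: unliftP => [j ->|->].
Qed.

Lemma mlift_comb p (U : lmodType rat) a (f1 f2 : ('I_p -> V) -> U) t :
  mlift (fun X => a *: f1 X + f2 X) t = a *: mlift f1 t + mlift f2 t.
Proof.
elim: p f1 f2 t => [|p IH] f1 f2 t /=.
  by rewrite scalerDr !scalerA mulrC.
case: p IH f1 f2 t => [//|p] IH f1 f2 t.
by rewrite -lift_combl; apply: eq_lift => v s; rewrite IH.
Qed.

Lemma mlift_spec p (U : lmodType rat) (f : ('I_p -> V) -> U) :
  multilinear f -> linear (mlift f) /\ forall X, mlift f (pure X) = f X.
Proof.
elim: p U f => [|p IH] U f fM /=.
  split=> [a u v|X]; first by rewrite scalerDl scalerA.
  by rewrite scale1r; congr f; apply/funext => -[].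
case: p IH f fM => [|p] IH f fM.
  have c v : (fun _ : 'I_1 => v) = upd (fun=> 0) ord0 v.
    by apply/funext => k; rewrite /upd (ord1 k) eqxx.
  split=> [a u v|X]; first by rewrite (c u) (c v) (c (a *: u + v)) fM.
  by congr f; apply/funext => k; rewrite (ord1 k).
have fB : bilin (fun v t => mlift (fun X => f (fcons v X)) t).
  split=> [t a u v|v]; last exact: (IH _ _ (multilinear_fcons v fM)).1.
  rewrite -mlift_comb; congr mlift; apply/funext => X.
  exact: multilinear_fcons0.
split; first exact: lift_linear.
move=> X; rewrite (lift_tens _ _ fB) (IH _ _ (multilinear_fcons _ fM)).2.
by rewrite fconsK.
Qed.

Lemma mlift_linear p (U : lmodType rat) (f : ('I_p -> V) -> U) :
  multilinear f -> linear (mlift f).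
Proof. by move/mlift_spec=> []. Qed.

Lemma mlift_pure p (U : lmodType rat) (f : ('I_p -> V) -> U) X :
  multilinear f -> mlift f (pure X) = f X.
Proof. by move/mlift_spec=> []. Qed.

Lemma tpow_ind p (P : tpow p -> Prop) :
  P 0 -> (forall a s t, P s -> P t -> P (a *: s + t)) ->
  (forall X, P (pure X)) -> forall t, P t.
Proof.
elim: p P => [|p IH] P P0 PD Pp t.
  rewrite -[t]addr0 -[t]mulr1; apply: PD => //; exact: (Pp (fun=> 0)).
case: p IH P P0 PD Pp t => [|p] IH P P0 PD Pp t; first exact: (Pp (fun=> t)).
rewrite (tensE t); apply: (big_ind P) => // [x y Px Py|[v s] _ /=].
  by rewrite -[x]scale1r; apply: PD.
apply: (IH (fun s => P (v ⊗ s))) => [|a x y Px Py|X].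
- by rewrite (bilin0r (@tens_bilin _ _)).
- by rewrite (@tens_bilin _ _).2; apply: PD.
have e : omit ord0 (fcons v X) = X.
  by apply/funext => k; rewrite /omit /fcons liftK.
by have := Pp (fcons v X); rewrite /= e {1}/fcons unlift_none.
Qed.

Lemma tpow_ext p (U : lmodType rat) (h k : tpow p -> U) :
  linear h -> linear k -> (forall X, h (pure X) = k (pure X)) -> h =1 k.
Proof.
move=> hL kL hk; apply: tpow_ind => [|a s t|//]; first by rewrite !lin0.
by rewrite hL kL => -> ->.
Qed.

Lemma upd_perm p (X : 'I_p -> V) (s : 'S_p) i v :
  (fun k => upd X i v (s k)) = upd (fun k => X (s k)) ((s^-1)%g i) v.
Proof.
by apply/funext => k; rewrite /upd -{1}(permKV s i) (inj_eq perm_inj).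
Qed.

Lemma multilinear_perm p (U : lmodType rat) (f : ('I_p -> V) -> U) (s : 'S_p) :
  multilinear f -> multilinear (fun X => f (fun i => X (s i))).
Proof. by move=> fM X i a u v; rewrite !upd_perm fM. Qed.

Lemma pureS p (X : 'I_p.+2 -> V) : pure X = X ord0 ⊗ pure (omit ord0 X).
Proof. by []. Qed.

Lemma multilinear_pure p : multilinear (@pure p).
Proof.
elim: p => [|p IH] X i; first by case: i.
case: p IH X i => [|p] IH X i a u v; first by rewrite /= /upd (ord1 i) eqxx.
rewrite !pureS.
case: (unliftP ord0 i) => [j ->|->].
  have e w : omit ord0 (upd X (fintype.lift ord0 j) w) = upd (omit ord0 X) j w.
    by apply/funext => k; rewrite /omit /upd (inj_eq lift_inj).
  by rewrite !e IH {1 2 3}/upd /= (@tens_bilin _ _).2.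
have e w : omit ord0 (upd X ord0 w) = omit ord0 X.
  by apply/funext => k; rewrite /omit /upd.
by rewrite !e {1 2 3}/upd eqxx (@tens_bilin _ _).1.
Qed.

Lemma multilinear_sum p (U : lmodType rat) (I : Type) (r : seq I) (P : pred I)
    (f : I -> ('I_p -> V) -> U) :
  (forall i, multilinear (f i)) ->
  multilinear (fun X => \sum_(i <- r | P i) f i X).
Proof.
by move=> fM X i; apply: linear_sumf => k; apply: fM.
Qed.

Lemma multilinear_scale p (U : lmodType rat) b (f : ('I_p -> V) -> U) :
  multilinear f -> multilinear (fun X => b *: f X).
Proof. by move=> fM X i; apply: linear_scale; apply: fM. Qed.

Lemma multilinear_comp p (U W : lmodType rat) (h : U -> W)
    (f : ('I_p -> V) -> U) :
  linear h -> multilinear f -> multilinear (fun X => h (f X)).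
Proof. by move=> hL fM X i; apply: (linear_comp hL); apply: fM. Qed.

(** The action of a permutation on tensors, permuting the factors *)
Definition perm_act p (s : 'S_p) : tpow p -> tpow p :=
  mlift (fun X => pure (fun i => X (s i))).

Lemma perm_act_linear p (s : 'S_p) : linear (perm_act s).
Proof. exact/mlift_linear/multilinear_perm/multilinear_pure. Qed.

Lemma perm_act_pure p (s : 'S_p) X :
  perm_act s (pure X) = pure (fun i => X (s i)).
Proof. exact/mlift_pure/multilinear_perm/multilinear_pure. Qed.

(** [ext_pow p] is the subspace of antisymmetric tensors of [tpow p]. *)
Definition antisym p : {pred tpow p} :=
  fun t => [forall s : 'S_p, perm_act s t == (-1) ^+ s *: t].

Lemma antisymP p (t : tpow p) :
  reflect (forall s : 'S_p, perm_act s t = (-1) ^+ s *: t) (t \in @antisym p).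
Proof. by apply: (iffP forallP) => h s; apply/eqP; apply: h. Qed.

Lemma antisym_closed p : submod_closed (@antisym p).
Proof.
split=> [|a u v /antisymP hu /antisymP hv]; apply/antisymP => s.
  by rewrite (lin0 (perm_act_linear s)) scaler0.
by rewrite perm_act_linear hu hv scalerDr !scalerA mulrC.
Qed.

HB.instance Definition _ p :=
  GRing.isSubmodClosed.Build rat (tpow p) (@antisym p) (@antisym_closed p).

Record ext_pow (p : nat) := ExtPow { ext_val : tpow p; _ : ext_val \in @antisym p }.

HB.instance Definition _ p := [isSub for @ext_val p].
HB.instance Definition _ p := [Choice of ext_pow p by <:].
HB.instance Definition _ p := [SubChoice_isSubLmodule of ext_pow p by <:].

End Multilinear.

Section Exterior.
Variable V : lmodType rat.

Definition alt p (X : 'I_p -> V) : tpow V p :=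
  \sum_(s : 'S_p) (-1) ^+ s *: pure (fun i => X (s i)).

Lemma alt_antisym p (X : 'I_p -> V) : alt X \in @antisym V p.
Proof.
apply/antisymP => t; rewrite (lin_sum (perm_act_linear t)) scaler_sumr.
rewrite (reindex_inj (mulgI t^-1)%g); apply: eq_bigr => s _.
rewrite (linZ (perm_act_linear t)) perm_act_pure odd_permM odd_permV signr_addb.
rewrite -scalerA; congr (_ *: (_ *: pure _)).
by apply/funext => i; rewrite permM permK.
Qed.

(** X_1 /\ ... /\ X_p *)
Definition wedge p (X : 'I_p -> V) : ext_pow V p := ExtPow (alt_antisym X).

(** For f multilinear and skew, [elift f] is the unique linear map with
    X_1 /\ ... /\ X_p |-> f X: see [elift_wedge] and [ext_ext]. The factor p!
    comes from the normalisation of the wedge product as a sum over all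
    permutations. *)
Definition elift p (U : lmodType rat) (f : ('I_p -> V) -> U) (xi : ext_pow V p) : U :=
  (p`!%:R)^-1 *: mlift f (ext_val xi).

(** The wedge product, characterised by [wedgep_wedge] *)
Definition wedgep p q (xi : ext_pow V p) (eta : ext_pow V q) : ext_pow V (p + q) :=
  elift (fun X => elift (fun Y => wedge (fcat X Y)) eta) xi.

Lemma ext_val_linear p : linear (@ext_val V p).
Proof. exact: (linearP (\val : {linear ext_pow V p -> tpow V p})). Qed.

Lemma ext_val_inj p : injective (@ext_val V p).
Proof. exact: val_inj. Qed.

Lemma wedge_multilinear p : multilinear (@wedge p).
Proof.
move=> X i a u v; apply: ext_val_inj; rewrite ext_val_linear /=.
suff: multilinear (@alt p) by apply.
apply: multilinear_sum => s; apply: multilinear_scale.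
exact/multilinear_perm/multilinear_pure.
Qed.

Lemma wedge_skew p : skew (@wedge p).
Proof.
move=> X t; apply: ext_val_inj.
rewrite (linZ (@ext_val_linear p)) /= /alt scaler_sumr.
rewrite (reindex_inj (mulIg t^-1)%g); apply: eq_bigr => s _.
rewrite odd_permM odd_permV addbC signr_addb -scalerA.
congr (_ *: (_ *: pure _)).
by apply/funext => i; rewrite permM permKV.
Qed.

Lemma fact_neq0 p : (p`!%:R : rat) != 0.
Proof. by rewrite Num.Theory.pnatr_eq0 -lt0n fact_gt0. Qed.

Lemma elift_linear p (U : lmodType rat) (f : ('I_p -> V) -> U) :
  multilinear f -> linear (elift f).
Proof.
by move=> fM; apply/linear_scale/linear_comp; [exact: mlift_linear | exact: ext_val_linear].
Qed.

Lemma elift_comb p (U : lmodType rat) a (f1 f2 : ('I_p -> V) -> U) xi :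
  elift (fun X => a *: f1 X + f2 X) xi = a *: elift f1 xi + elift f2 xi.
Proof. by rewrite /elift mlift_comb scalerDr !scalerA mulrC. Qed.

Lemma elift_wedge p (U : lmodType rat) (f : ('I_p -> V) -> U) X :
  multilinear f -> skew f -> elift f (wedge X) = f X.
Proof.
move=> fM fS; rewrite /elift /= /alt (lin_sum (mlift_linear fM)).
under eq_bigr => s _ do
  rewrite (linZ (mlift_linear fM)) (mlift_pure _ fM) fS scalerA -signr_addb addbb scale1r.
by rewrite sumr_const card_Sn -scaler_nat scalerA mulVf ?fact_neq0 // scale1r.
Qed.

Lemma mlift_wedge p (t : tpow V p) :
  ext_val (mlift (@wedge p) t) = \sum_(s : 'S_p) (-1) ^+ s *: perm_act s t.
Proof.
have L := mlift_linear (@wedge_multilinear p).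
move: t; apply: tpow_ext => [||X].
- exact: (linear_comp (@ext_val_linear p)).
- by apply: linear_sumf => s; apply/linear_scale/perm_act_linear.
- rewrite (mlift_pure _ (@wedge_multilinear p)) /=.
  by apply: eq_bigr => s _; rewrite perm_act_pure.
Qed.

Lemma elift_id p (xi : ext_pow V p) : elift (@wedge p) xi = xi.
Proof.
apply: ext_val_inj; rewrite /elift (linZ (@ext_val_linear p)) mlift_wedge.
have /antisymP xiA : ext_val xi \in @antisym V p := valP xi.
under eq_bigr => s _ do rewrite xiA scalerA -signr_addb addbb scale1r.
by rewrite sumr_const card_Sn -scaler_nat scalerA mulVf ?fact_neq0 // scale1r.
Qed.

Lemma ext_ind p (P : ext_pow V p -> Prop) :
  P 0 -> (forall a s t, P s -> P t -> P (a *: s + t)) ->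
  (forall X, P (wedge X)) -> forall xi, P xi.
Proof.
move=> P0 PD Pw xi; rewrite -(elift_id xi) /elift.
rewrite -[_ *: _]addr0; apply: (PD) => //.
have L := mlift_linear (@wedge_multilinear p).
move: (ext_val xi); apply: tpow_ind => [|a s t Ps Pt|X]; first by rewrite (lin0 L).
  by rewrite L; apply: PD.
by rewrite mlift_pure //; apply: wedge_multilinear.
Qed.

Lemma ext_ext p (U : lmodType rat) (h k : ext_pow V p -> U) :
  linear h -> linear k -> (forall X, h (wedge X) = k (wedge X)) -> h =1 k.
Proof.
move=> hL kL hk; apply: ext_ind => [|a s t|//]; first by rewrite !lin0.
by rewrite hL kL => -> ->.
Qed.

Lemma tperm_skew p (U : lmodType rat) (f : ('I_p -> V) -> U) :
  (forall X (i j : 'I_p), i != j -> f (fun k => X (tperm i j k)) = - f X) ->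
  skew f.
Proof.
move=> fT X s; case: (prod_tpermP s) => ts -> ts_neq.
elim: ts X ts_neq => [|t ts IH] X /=.
  rewrite big_nil odd_perm1 scale1r => _; congr f.
  by apply/funext => i; rewrite perm1.
case/andP=> t_neq /IH {}IH; rewrite big_cons odd_permM odd_tperm t_neq /=.
set s' := (\prod_(t0 <- ts) tperm t0.1 t0.2)%g in IH *.
have -> : (fun i => X ((tperm t.1 t.2 * s')%g i)) =
          (fun k => (fun i => X (s' i)) (tperm t.1 t.2 k)).
  by apply/funext => i; rewrite permM.
by rewrite (fT (fun i => X (s' i)) _ _ t_neq) IH signrN scaleNr.
Qed.

Lemma fcatl p q (X : 'I_p -> V) (Y : 'I_q -> V) i : fcat X Y (lshift q i) = X i.
Proof. by rewrite /fcat (unsplitK (inl _ i)). Qed.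

Lemma fcatr p q (X : 'I_p -> V) (Y : 'I_q -> V) i : fcat X Y (rshift p i) = Y i.
Proof. by rewrite /fcat (unsplitK (inr _ i)). Qed.

Lemma fcat_updl p q (X : 'I_p -> V) (Y : 'I_q -> V) i v :
  fcat (upd X i v) Y = upd (fcat X Y) (lshift q i) v.
Proof.
apply/funext => k; rewrite -[k]splitK; case: (split k) => l; rewrite /unsplit /upd.
  by rewrite !fcatl (inj_eq (@lshift_inj _ _)).
by rewrite !fcatr eq_rlshift.
Qed.

Lemma fcat_updr p q (X : 'I_p -> V) (Y : 'I_q -> V) i v :
  fcat X (upd Y i v) = upd (fcat X Y) (rshift p i) v.
Proof.
apply/funext => k; rewrite -[k]splitK; case: (split k) => l; rewrite /unsplit /upd.
  by rewrite !fcatl eq_lrshift.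
by rewrite !fcatr (inj_eq (@rshift_inj _ _)).
Qed.

Lemma fcat_tperml p q (X : 'I_p -> V) (Y : 'I_q -> V) i j :
  fcat (fun k => X (tperm i j k)) Y =
  (fun k => fcat X Y (tperm (lshift q i) (lshift q j) k)).
Proof.
apply/funext => k; rewrite -[k]splitK; case: (split k) => l; rewrite /unsplit.
  rewrite fcatl; case: tpermP => [->|->|/eqP li /eqP lj]; rewrite ?tpermL ?tpermR ?fcatl //.
  by rewrite tpermD ?fcatl // eq_sym (inj_eq (@lshift_inj _ _)).
by rewrite fcatr tpermD ?fcatr // eq_lrshift.
Qed.

Lemma fcat_tpermr p q (X : 'I_p -> V) (Y : 'I_q -> V) i j :
  fcat X (fun k => Y (tperm i j k)) =
  (fun k => fcat X Y (tperm (rshift p i) (rshift p j) k)).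
Proof.
apply/funext => k; rewrite -[k]splitK; case: (split k) => l; rewrite /unsplit.
  by rewrite fcatl tpermD ?fcatl // eq_rlshift.
rewrite fcatr; case: tpermP => [->|->|/eqP li /eqP lj]; rewrite ?tpermL ?tpermR ?fcatr //.
by rewrite tpermD ?fcatr // eq_sym (inj_eq (@rshift_inj _ _)).
Qed.

Lemma wedge_tperm p (X : 'I_p -> V) i j : i != j ->
  wedge (fun k => X (tperm i j k)) = - wedge X.
Proof. by move=> ij; rewrite wedge_skew odd_tperm ij scaleN1r. Qed.

Lemma wedgep_multilinear2 p q (X : 'I_p -> V) :
  multilinear (fun Y : 'I_q -> V => wedge (fcat X Y)).
Proof. by move=> Y i a u v; rewrite !fcat_updr wedge_multilinear. Qed.

Lemma wedgep_skew2 p q (X : 'I_p -> V) :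
  skew (fun Y : 'I_q -> V => wedge (fcat X Y)).
Proof.
apply: tperm_skew => Y i j ij; rewrite fcat_tpermr wedge_tperm //.
by rewrite (inj_eq (@rshift_inj _ _)).
Qed.

Lemma wedgep_multilinear1 p q (eta : ext_pow V q) :
  multilinear (fun X : 'I_p -> V => elift (fun Y => wedge (fcat X Y)) eta).
Proof.
move=> X i a u v; rewrite -elift_comb; congr elift; apply/funext => Y.
by rewrite !fcat_updl wedge_multilinear.
Qed.

Lemma wedgep_skew1 p q (eta : ext_pow V q) :
  skew (fun X : 'I_p -> V => elift (fun Y => wedge (fcat X Y)) eta).
Proof.
apply: tperm_skew => X i j ij.
rewrite -scaleN1r -[RHS]addr0.
have e0 : elift (fun Y : 'I_q -> V => 0 : ext_pow V (p + q)) eta = 0.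
  rewrite -[RHS](addNr (elift (fun Y : 'I_q -> V => 0 : ext_pow V (p + q)) eta)).
  rewrite -scaleN1r -elift_comb; congr elift; apply/funext => Y.
  by rewrite scaler0 addr0.
rewrite -[X in _ + X]e0 -elift_comb; congr elift; apply/funext => Y.
by rewrite fcat_tperml wedge_tperm ?scaleN1r ?addr0.
Qed.

Lemma wedgep_wedge p q (X : 'I_p -> V) (Y : 'I_q -> V) :
  wedgep (wedge X) (wedge Y) = wedge (fcat X Y).
Proof.
rewrite /wedgep (elift_wedge _ (@wedgep_multilinear1 _ _ _) (@wedgep_skew1 _ _ _)).
by rewrite (elift_wedge _ (@wedgep_multilinear2 _ _ _) (@wedgep_skew2 _ _ _)).
Qed.

Lemma wedgep_bilin p q : bilin (@wedgep p q).
Proof.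
split=> [eta|xi]; first exact/elift_linear/wedgep_multilinear1.
move=> a u v; rewrite /wedgep -elift_comb; congr elift; apply/funext => X.
exact/elift_linear/wedgep_multilinear2.
Qed.

End Exterior.

Lemma lift_permP p (s : 'S_p.+1) i : exists s' : 'S_p, s = lift_perm i (s i) s'.
Proof.
have sP k : exists j, s (fintype.lift i k) = fintype.lift (s i) j.
  case: (unliftP (s i) (s (fintype.lift i k))) => [j ->|/perm_inj/eqP]; first by exists j.
  by rewrite eq_sym (negbTE (neq_lift _ _)).
pose f k := odflt k (unlift (s i) (s (fintype.lift i k))).
have fP k : s (fintype.lift i k) = fintype.lift (s i) (f k).
  by rewrite /f; have [j ->] := sP k; rewrite liftK.
have f_inj : injective f.
  by move=> k l /(congr1 (fintype.lift (s i))); rewrite -!fP => /perm_inj/lift_inj.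
exists (perm f_inj); apply/permP => k.
case: (unliftP i k) => [j ->|->]; last by rewrite lift_perm_id.
by rewrite lift_perm_lift permE fP.
Qed.

Section OmitSum.
Variables (V U : lmodType rat) (p : nat) (F : V -> ('I_p -> V) -> U).

Definition omit_sum (X : 'I_p.+1 -> V) : U :=
  \sum_(i < p.+1) (-1) ^+ i *: F (X i) (omit i X).

Lemma omit_sum_skew : (forall v, skew (F v)) -> skew omit_sum.
Proof.
move=> FS X s; rewrite /omit_sum scaler_sumr [RHS](reindex_inj (@perm_inj _ s)).
apply: eq_bigr => i _; have [s' es] := lift_permP s i.
have -> : omit i (fun k => X (s k)) = fun k => omit (s i) X (s' k).
  by apply/funext => k; rewrite /omit {1}es lift_perm_lift.
rewrite FS !scalerA; congr (_ *: _).
have -> : (-1) ^+ s = (-1) ^+ i * (-1) ^+ s i * (-1) ^+ s' :> rat.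
  by rewrite [X in (-1) ^+ nat_of_bool (odd_perm X) = _]es odd_lift_perm
    !signr_addb !signr_odd.
have sq n : (-1) ^+ n * (-1) ^+ n = 1 :> rat.
  by rewrite -exprD addnn -signr_odd odd_double.
by rewrite [RHS]mulrAC -[X in _ = X * _]mulrA sq mulr1.
Qed.

Lemma omit_upd_eq (X : 'I_p.+1 -> V) i v : omit i (upd X i v) = omit i X.
Proof.
by apply/funext => k; rewrite /omit /upd eq_sym (negbTE (neq_lift _ _)).
Qed.

Lemma omit_upd_lift (X : 'I_p.+1 -> V) i j v :
  omit i (upd X (fintype.lift i j) v) = upd (omit i X) j v.
Proof. by apply/funext => k; rewrite /omit /upd (inj_eq lift_inj). Qed.

Lemma omit_sum_multilinear :
  (forall Y, linear (F^~ Y)) -> (forall v, multilinear (F v)) ->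
  multilinear omit_sum.
Proof.
move=> FL FM X k; apply: linear_sumf => i; apply: linear_scale.
case: (unliftP i k) => [j ->|->] a u v; last first.
  by rewrite !omit_upd_eq /upd eqxx FL.
have e w : upd X (fintype.lift i j) w i = X i by rewrite /upd (negbTE (neq_lift _ _)).
by rewrite !omit_upd_lift !e FM.
Qed.
End OmitSum.

Section Operators.
Variables (g : lmodType rat) (nabla : {linear (g ⊗ g)%type -> g}).
Variable (delta : {linear g -> ext_pow g 2}).

Definition bracket (X Y : g) : g := nabla (X ⊗ Y).

Lemma bracket_bilin : bilin bracket.
Proof.
split=> [Y|X] a u v; rewrite /bracket.
  by rewrite (@tens_bilin g g).1 linearP.
by rewrite (@tens_bilin g g).2 linearP.
Qed.

Definition is_lie_algebra : Prop :=
  (forall X, bracket X X = 0) /\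
  (forall X Y Z, bracket X (bracket Y Z) + bracket Y (bracket Z X)
                 + bracket Z (bracket X Y) = 0).

Lemma bracketC X Y : is_lie_algebra -> bracket X Y = - bracket Y X.
Proof.
case=> br0 _; have := br0 (X + Y).
rewrite !(bilinDl bracket_bilin) !(bilinDr bracket_bilin) !br0 add0r addr0.
by move/eqP; rewrite addr_eq0 => /eqP.
Qed.

Definition sigma (Y : g) p : ext_pow g p -> ext_pow g p :=
  elift (fun X => \sum_(i < p) wedge (upd X i (bracket Y (X i)))).

(** X_1, ..., X_p with the entries of indices i < j omitted; deleting j first
    leaves the position of i unchanged. *)
Definition omit2 q (i j : 'I_q.+2) (X : 'I_q.+2 -> g) : 'I_q -> g :=
  omit (inord i) (omit j X).

(** Indices start at 0, which does not affect the sign (-1)^(i+j). The formula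
    is skew by antisymmetry of the bracket, so that [bdry] takes the prescribed
    values on decomposable elements: see [bdry_wedge]. *)
Definition bdry p : ext_pow g p.+1 -> ext_pow g p :=
  match p return ext_pow g p.+1 -> ext_pow g p with
  | 0 => fun _ => 0
  | q.+1 => elift (fun X : 'I_q.+2 -> g =>
      \sum_(i < q.+2) \sum_(j < q.+2 | (i < j)%N)
        (-1) ^+ (i + j) *: wedge (fcons (bracket (X i) (X j)) (omit2 i j X)))
  end.

(** Indices start at 0, hence the sign (-1)^(i+1). The values on decomposable
    elements are given by [cobdry_wedge]. *)
Definition cobdry p : ext_pow g p -> ext_pow g p.+1 :=
  match p return ext_pow g p -> ext_pow g p.+1 with
  | 0 => fun _ => 0
  | q.+1 => elift (fun X : 'I_q.+1 -> g =>
      \sum_(i < q.+1) (-1) ^+ i.+1 *: wedgep (delta (X i)) (wedge (omit i X)))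
  end.

Lemma upd_upd_perm p (X : 'I_p -> g) (s : 'S_p) i v :
  upd (fun k => X (s k)) i v = fun k => upd X (s i) v (s k).
Proof. by apply/funext => k; rewrite /upd (inj_eq perm_inj). Qed.

Lemma sigma_multilinear Y p :
  multilinear (fun X : 'I_p -> g => \sum_(i < p) wedge (upd X i (bracket Y (X i)))).
Proof.
apply: multilinear_sum => i Z k.
have [<-|ik] := eqVneq i k => a u v.
  have e w : upd (upd Z i w) i (bracket Y (upd Z i w i)) = upd Z i (bracket Y w).
    by apply/funext => l; rewrite /upd eqxx; case: eqP.
  by rewrite !e bracket_bilin.2 wedge_multilinear.
have e w : upd (upd Z k w) i (bracket Y (upd Z k w i)) =
           upd (upd Z i (bracket Y (Z i))) k w.
  apply/funext => l; rewrite /upd (negbTE ik).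
  by case: eqP => [->|//]; rewrite (negbTE ik).
by rewrite !e wedge_multilinear.
Qed.

Lemma sigma_linear Y p : linear (@sigma Y p).
Proof. exact/elift_linear/sigma_multilinear. Qed.

Lemma sigma_wedge Y p (X : 'I_p -> g) :
  sigma Y (wedge X) = \sum_(i < p) wedge (upd X i (bracket Y (X i))).
Proof.
rewrite /sigma elift_wedge //; first exact: sigma_multilinear.
move=> Z s; rewrite scaler_sumr [RHS](reindex_inj (@perm_inj _ s)).
by apply: eq_bigr => i _; rewrite upd_upd_perm wedge_skew.
Qed.

Lemma sigma_linear_l p (xi : ext_pow g p) : linear (fun Y => sigma Y xi).
Proof.
move=> a Y Z; rewrite /sigma -elift_comb; congr elift; apply/funext => X.
rewrite scaler_sumr -big_split; apply: eq_bigr => i _ /=.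
by rewrite bracket_bilin.1 wedge_multilinear.
Qed.

Lemma cobdry0 xi : @cobdry 0 xi = 0.
Proof. by []. Qed.

Section CobdryWedge.
Variable p : nat.

Let F v (Y : 'I_p -> g) := - wedgep (delta v) (wedge Y) : ext_pow g (2 + p).

Let F_skew v : skew (F v).
Proof.
by move=> Y s; rewrite /F wedge_skew (bilinZr (@wedgep_bilin _ _ _)) scalerN.
Qed.

Let F_multilinear v : multilinear (F v).
Proof.
move=> Y i a u w; rewrite /F wedge_multilinear (@wedgep_bilin _ _ _).2.
by rewrite opprD scalerN.
Qed.

Let F_lin Y : linear (F^~ Y).
Proof.
by move=> a u w; rewrite /F linearP (@wedgep_bilin _ _ _).1 opprD scalerN.
Qed.

Let FE : (fun X : 'I_p.+1 -> g => \sum_(i < p.+1)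
  (-1) ^+ i.+1 *: wedgep (delta (X i)) (wedge (omit i X))) = omit_sum F.
Proof.
apply/funext => Y; apply: eq_bigr => i _.
by rewrite exprS mulN1r scaleNr /F scalerN.
Qed.

Lemma cobdry_wedge (X : 'I_p.+1 -> g) :
  cobdry (wedge X) =
  \sum_(i < p.+1) (-1) ^+ i.+1 *: wedgep (delta (X i)) (wedge (omit i X)).
Proof.
have /(congr1 (fun h => h X))/= -> := FE.
rewrite /cobdry FE elift_wedge //; first exact: omit_sum_multilinear.
exact: omit_sum_skew.
Qed.

Lemma cobdry_linear_succ : linear (@cobdry p.+1).
Proof. by apply: elift_linear; rewrite FE; apply: omit_sum_multilinear. Qed.
End CobdryWedge.

Lemma cobdry_linear p : linear (@cobdry p).
Proof. by case: p => [|p]; [exact: linear_zero | exact: cobdry_linear_succ]. Qed.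

Lemma bdry0 xi : @bdry 0 xi = 0.
Proof. by []. Qed.

Lemma fcons_skew p v : skew (fun Z : 'I_p -> g => wedge (fcons v Z)).
Proof.
move=> Z s.
have -> : fcons v (fun k => Z (s k)) = (fun k => fcons v Z (lift_perm ord0 ord0 s k)).
  apply/funext => k; case: (unliftP ord0 k) => [j ->|->].
    by rewrite lift_perm_lift /fcons !liftK.
  by rewrite lift_perm_id /fcons unlift_none.
by rewrite wedge_skew odd_lift_perm.
Qed.

Lemma bump2 i j k : (j <= i)%N -> bump j (bump i k) = bump i.+1 (bump j k).
Proof.
move=> ji; rewrite /bump; case: (leqP i k) => ik.
  by rewrite (leq_trans ji ik) /= !add1n ltnS ik (leq_trans ji (leqW ik)).
rewrite add0n; case: (leqP j k) => jk; rewrite !(add0n, add1n).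
  by rewrite ltnS leqNgt ik.
by rewrite ltnNge (ltnW ik).
Qed.

Section BdryWedge.
Variable q : nat.
Hypothesis Lg : is_lie_algebra.
Implicit Type X : 'I_q.+2 -> g.

Let G X := \sum_(i < q.+2) \sum_(j < q.+2 | (i < j)%N)
        (-1) ^+ (i + j) *: wedge (fcons (bracket (X i) (X j)) (omit2 i j X)).

Let B v w (Z : 'I_q -> g) := wedge (fcons (bracket w v) Z).

Let A X := omit_sum (fun v => omit_sum (B v)) X.

Let S X (i j : 'I_q.+2) : ext_pow g q.+1 :=
  if (i < j)%N
  then (-1) ^+ (i + j) *: wedge (fcons (bracket (X i) (X j)) (omit2 i j X))
  else (-1) ^+ (i + j) *: wedge (fcons (bracket (X j) (X i)) (omit2 j i X)).

Let fconsN v (Z : 'I_q -> g) : wedge (fcons (- v) Z) = - wedge (fcons v Z).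
Proof.
have L := multilinear_fcons0 Z (@wedge_multilinear g q.+1).
by rewrite -scaleN1r (linZ L) scaleN1r.
Qed.

Let AE X : A X = \sum_(j < q.+2) \sum_(i < q.+2 | i != j) S X i j.
Proof.
apply: eq_bigr => j _; rewrite scaler_sumr [RHS]big_mkcond (bigD1_ord j) //=.
rewrite eqxx add0r; apply: eq_bigr => i _.
rewrite eq_sym neq_lift scalerA -exprD /B /S /omit2.
case: ltnP => /= [ij|ji].
  have ij' : (i < j)%N by move: ij; rewrite /bump; case: leqP => //; lia.
  have e : bump j i = i by rewrite /bump leqNgt ij'.
  have -> : inord (fintype.lift j i) = i :> 'I_q.+1.
    by apply: val_inj; rewrite /= inordK e.
  by rewrite e addnC.
have ji' : (j <= i)%N by move: ji; rewrite /bump; case: leqP => //; lia.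
have e : bump j i = i.+1 by rewrite /bump ji'.
rewrite e addSn exprS mulN1r addnC scaleNr -scalerN -fconsN -(bracketC _ _ Lg).
congr (_ *: wedge (fcons _ _)); apply/funext => k.
rewrite /omit; congr X; apply: val_inj => /=.
rewrite inordK; last by apply: leq_ltn_trans ji' _.
rewrite e; exact: bump2.
Qed.

Let A2G X : A X = 2%:R *: G X.
Proof.
have GE : G X = \sum_(j < q.+2) \sum_(i < q.+2 | (i < j)%N) S X i j.
  rewrite (exchange_big_dep xpredT) //=; apply: eq_bigr => i _; apply: eq_bigr => j ij.
  by rewrite /S ij.
have GE' : G X = \sum_(j < q.+2) \sum_(i < q.+2 | (j < i)%N) S X i j.
  apply: eq_bigr => j _; apply: eq_bigr => i ji.
  by rewrite /S ltnNge (ltnW ji) addnC.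
rewrite scaler_nat mulr2n {1}GE GE' AE -big_split; apply: eq_bigr => j _ /=.
rewrite (bigID (fun i : 'I_q.+2 => (i < j)%N)) /=; congr (_ + _);
  by apply: eq_bigl => i; rewrite -val_eqE /=; case: ltngtP.
Qed.

Let GA : G = (fun X => 2%:R^-1 *: A X).
Proof. by apply/funext => X; rewrite A2G scalerA mulVf // scale1r. Qed.

Let B_skew v w : skew (B v w).
Proof. exact: fcons_skew. Qed.

Let B_multilinear v w : multilinear (B v w).
Proof. exact: multilinear_fcons (@wedge_multilinear g q.+1). Qed.

Let B_lin v Z : linear ((B v)^~ Z).
Proof.
apply: (linear_comp (multilinear_fcons0 Z (@wedge_multilinear g q.+1))).
exact: bracket_bilin.1.
Qed.

Let B_lin' w Z : linear (fun v => B v w Z).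
Proof.
apply: (linear_comp (multilinear_fcons0 Z (@wedge_multilinear g q.+1))).
exact: bracket_bilin.2.
Qed.

Lemma bdry_multilinear : multilinear G.
Proof.
rewrite GA; apply: multilinear_scale; apply: omit_sum_multilinear => [Y|v].
  by apply: linear_sumf => i; apply: linear_scale; exact: B_lin'.
by apply: omit_sum_multilinear => [Z|w]; [exact: B_lin | exact: B_multilinear].
Qed.

Lemma bdry_wedge X : bdry (wedge X) =
  \sum_(i < q.+2) \sum_(j < q.+2 | (i < j)%N)
     (-1) ^+ (i + j) *: wedge (fcons (bracket (X i) (X j)) (omit2 i j X)).
Proof.
rewrite /bdry elift_wedge //; first exact: bdry_multilinear.
rewrite -/G GA => Y s.
rewrite /A omit_sum_skew; last by move=> v; apply: omit_sum_skew => w; exact: B_skew.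
by rewrite !scalerA mulrC.
Qed.
End BdryWedge.

Lemma bdry_linear p : is_lie_algebra -> linear (@bdry p).
Proof.
case: p => [|q] Lg; first exact: linear_zero.
exact: (elift_linear (bdry_multilinear Lg)).
Qed.
End Operators.

Section Bialgebra.
Variables (g : lmodType rat) (nabla : {linear (g ⊗ g)%type -> g}).
Variable (delta : {linear g -> ext_pow g 2}).

(** [delta] with values in [g ⊗ g], which is [tpow g 2] by definition *)
Definition delta2 (X : g) : g ⊗ g := @ext_val g 2 (delta X).

(** The cyclic permutation X (x) Y (x) Z |-> Z (x) X (x) Y *)
Definition cyc (t : g ⊗ (g ⊗ g)) : g ⊗ (g ⊗ g) := flip (assocl t).

Definition cyc_sum (t : g ⊗ (g ⊗ g)) : g ⊗ (g ⊗ g) := t + cyc t + cyc (cyc t).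

Record involutive_lie_bialgebra : Prop := InvolutiveLieBialgebra {
  ilb_lie : is_lie_algebra nabla;
  ilb_coJacobi : forall X, cyc_sum (assocr (tmap delta2 id (delta2 X))) = 0;
  ilb_compat : forall X Y, delta (bracket nabla X Y) =
                 sigma nabla X (delta Y) - sigma nabla Y (delta X);
  ilb_invol : forall X, nabla (delta2 X) = 0 }.

End Bialgebra.

Section Coefficients.
Variables (g : lmodType rat) (nabla : {linear (g ⊗ g)%type -> g}).
Variable (delta : {linear g -> ext_pow g 2}).
Variables (M : lmodType rat) (act : {linear (g ⊗ M)%type -> M}).
Variable (mu : {linear M -> (M ⊗ g)%type}).

Definition is_lie_module : Prop := forall X Y m,
  act (bracket nabla X Y ⊗ m) = act (X ⊗ act (Y ⊗ m)) - act (Y ⊗ act (X ⊗ m)).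

Definition sigmabar : M ⊗ g -> M := lift (fun m X => - act (X ⊗ m)).

Definition sigmaM (Y : g) p : M ⊗ ext_pow g p -> M ⊗ ext_pow g p :=
  lift (fun m xi => act (Y ⊗ m) ⊗ xi + m ⊗ sigma nabla Y xi).

(** Indices start at 0, hence the sign (-1)^(i+1); see [Gamma_wedge]. *)
Definition Gamma p : M ⊗ ext_pow g p.+1 -> M ⊗ ext_pow g p :=
  lift (fun m => elift (fun X : 'I_p.+1 -> g =>
    \sum_(i < p.+1) (-1) ^+ i.+1 *: (act (X i ⊗ m) ⊗ wedge (omit i X)))).

(** The boundary operator in positive degrees; it is zero on M (x) Lambda^0. *)
Definition bdryM p : M ⊗ ext_pow g p.+1 -> M ⊗ ext_pow g p :=
  lift (fun m xi => Gamma (m ⊗ xi) + m ⊗ bdry nabla xi).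

Definition wedgeM p q (u : M ⊗ ext_pow g p) (eta : ext_pow g q)
  : M ⊗ ext_pow g (p + q) := tmap id (fun xi => wedgep xi eta) u.

(** The identification of M (x) g with M (x) Lambda^1 g and its inverse *)
Definition to_ext1 : M ⊗ g -> M ⊗ ext_pow g 1 :=
  tmap id (fun X => wedge (fun _ : 'I_1 => X)).
Definition of_ext1 : M ⊗ ext_pow g 1 -> M ⊗ g := tmap id (@ext_val g 1).

Definition cobdryM p : M ⊗ ext_pow g p -> M ⊗ ext_pow g p.+1 :=
  lift (fun m xi => wedgeM (to_ext1 (mu m)) xi + m ⊗ cobdry delta xi).

Definition is_comodule : Prop := forall m,
  tmap id (delta2 delta) (mu m) =
  tmap id (fun t => t - flip t) (assocr (tmap mu id (mu m))).

Definition is_bimodule : Prop :=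
  is_comodule /\
  forall m Y,
    of_ext1 (sigmaM Y (to_ext1 (mu m))) - mu (act (Y ⊗ m))
    - tmap sigmabar id (assocl (tmap id (delta2 delta) (m ⊗ Y))) = 0.

Definition is_involutive_bimodule : Prop :=
  is_bimodule /\ forall m, sigmabar (mu m) = 0.

Lemma act_bilin : bilin (fun X m => act (X ⊗ m)).
Proof.
by split=> [m|X] a u v; rewrite ?(@tens_bilin g M).1 ?(@tens_bilin g M).2 linearP.
Qed.

Lemma sigmabar_bilin : bilin (fun m X => - act (X ⊗ m)).
Proof.
by split=> [X|m] a u v; rewrite ?act_bilin.2 ?act_bilin.1 opprD scalerN.
Qed.

Lemma sigmabar_tens m X : sigmabar (m ⊗ X) = - act (X ⊗ m).
Proof. exact: lift_tens sigmabar_bilin. Qed.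

Lemma sigmabar_linear : linear sigmabar.
Proof. exact: lift_linear sigmabar_bilin. Qed.

Lemma sigmaM_bilin Y p :
  bilin (fun m (xi : ext_pow g p) => act (Y ⊗ m) ⊗ xi + m ⊗ sigma nabla Y xi).
Proof.
split=> [xi|m] a u v.
  by rewrite act_bilin.2 !(@tens_bilin M _).1 scalerDr addrACA.
by rewrite sigma_linear !(@tens_bilin M _).2 scalerDr addrACA.
Qed.

Lemma sigmaM_tens Y p m (xi : ext_pow g p) :
  sigmaM Y (m ⊗ xi) = act (Y ⊗ m) ⊗ xi + m ⊗ sigma nabla Y xi.
Proof. exact: (lift_tens _ _ (sigmaM_bilin Y p)). Qed.

Lemma sigmaM_linear Y p : linear (@sigmaM Y p).
Proof. exact: (lift_linear (sigmaM_bilin Y p)). Qed.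

Section GammaTheory.
Variable p : nat.

Let F m v (Y : 'I_p -> g) := - (act (v ⊗ m) ⊗ wedge Y).

Let F_skew m v : skew (F m v).
Proof.
by move=> Y s; rewrite /F wedge_skew (bilinZr (@tens_bilin M _)) scalerN.
Qed.

Let F_multilinear m v : multilinear (F m v).
Proof.
move=> Y i a u w; rewrite /F wedge_multilinear (@tens_bilin M _).2.
by rewrite opprD scalerN.
Qed.

Let F_lin m Y : linear ((F m)^~ Y).
Proof.
by move=> a u w; rewrite /F act_bilin.1 (@tens_bilin M _).1 opprD scalerN.
Qed.

Let FE m : (fun X : 'I_p.+1 -> g => \sum_(i < p.+1)
  (-1) ^+ i.+1 *: (act (X i ⊗ m) ⊗ wedge (omit i X))) = omit_sum (F m).
Proof.
apply/funext => Y; apply: eq_bigr => i _.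
by rewrite exprS mulN1r scaleNr /F scalerN.
Qed.

Let Gamma_bilin : bilin (fun m => elift (fun X : 'I_p.+1 -> g =>
  \sum_(i < p.+1) (-1) ^+ i.+1 *: (act (X i ⊗ m) ⊗ wedge (omit i X)))).
Proof.
split=> [xi|m]; last by apply: elift_linear; rewrite FE; apply: omit_sum_multilinear.
move=> a u v; rewrite -elift_comb; congr elift; apply/funext => X.
rewrite scaler_sumr -big_split; apply: eq_bigr => i _ /=.
rewrite act_bilin.2 (@tens_bilin M _).1 scalerDr.
by rewrite !scalerA mulrC.
Qed.

Lemma Gamma_wedge m (X : 'I_p.+1 -> g) : Gamma (m ⊗ wedge X) =
  \sum_(i < p.+1) (-1) ^+ i.+1 *: (act (X i ⊗ m) ⊗ wedge (omit i X)).
Proof.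
rewrite /Gamma (lift_tens _ _ Gamma_bilin).
have /(congr1 (fun h => h X))/= -> := FE m.
rewrite FE elift_wedge //; first exact: omit_sum_multilinear.
exact: omit_sum_skew.
Qed.

Lemma Gamma_linear : linear (@Gamma p).
Proof. exact: (lift_linear Gamma_bilin). Qed.
End GammaTheory.

Lemma bdryM_bilin p : is_lie_algebra nabla ->
  bilin (fun m (xi : ext_pow g p.+1) => Gamma (m ⊗ xi) + m ⊗ bdry nabla xi).
Proof.
move=> Lg; split=> [xi|m] a u v.
  by rewrite !(@tens_bilin M _).1 Gamma_linear scalerDr addrACA.
by rewrite (bdry_linear Lg) !(@tens_bilin M _).2 Gamma_linear scalerDr addrACA.
Qed.

Lemma bdryM_tens p m (xi : ext_pow g p.+1) : is_lie_algebra nabla ->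
  bdryM (m ⊗ xi) = Gamma (m ⊗ xi) + m ⊗ bdry nabla xi.
Proof. by move=> Lg; apply: (lift_tens _ _ (bdryM_bilin p Lg)). Qed.

Lemma bdryM_linear p : is_lie_algebra nabla -> linear (@bdryM p).
Proof. by move=> Lg; apply: (lift_linear (bdryM_bilin p Lg)). Qed.

Lemma wedgeM_tens p q m (xi : ext_pow g p) (eta : ext_pow g q) :
  wedgeM (m ⊗ xi) eta = m ⊗ wedgep xi eta.
Proof. by rewrite /wedgeM tmap_tens //; apply: (@wedgep_bilin _ _ _).1. Qed.

Lemma wedgeM_bilin p q : bilin (@wedgeM p q).
Proof.
split=> [eta|u]; first by apply: tmap_linear => //; apply: (@wedgep_bilin _ _ _).1.
move=> a eta zeta; rewrite /wedgeM /tmap -lift_combl; apply: eq_lift => m xi.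
by rewrite (@wedgep_bilin _ _ _).2 (@tens_bilin M _).2.
Qed.

Lemma wedge1_linear : linear (fun X : g => wedge (fun _ : 'I_1 => X)).
Proof. by move=> a u v; apply: ext_val_inj; rewrite ext_val_linear /= /alt
  scaler_sumr -big_split; apply: eq_bigr => s _ /=; rewrite scalerDr !scalerA mulrC. Qed.

Lemma ext_val_wedge1 (X : g) : @ext_val g 1 (wedge (fun _ : 'I_1 => X)) = X.
Proof.
rewrite /= /alt (big_pred1 (1%g : 'S_1)) => [|s].
  by rewrite odd_perm1 scale1r.
by apply/esym/eqP/permP => i; rewrite !ord1.
Qed.

Lemma to_ext1_tens m X : to_ext1 (m ⊗ X) = m ⊗ wedge (fun _ : 'I_1 => X).
Proof. exact: tmap_tens (@linear_id M) wedge1_linear. Qed.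

Lemma to_ext1_linear : linear to_ext1.
Proof. exact: tmap_linear (@linear_id M) wedge1_linear. Qed.

Lemma of_ext1_tens m xi : of_ext1 (m ⊗ xi) = m ⊗ (ext_val xi : g).
Proof. exact: tmap_tens (@linear_id M) (@ext_val_linear g 1). Qed.

Lemma of_ext1_linear : linear of_ext1.
Proof. exact: tmap_linear (@linear_id M) (@ext_val_linear g 1). Qed.

Lemma to_ext1K : cancel to_ext1 of_ext1.
Proof.
apply: tens_lext => [||m X].
- exact: linear_comp of_ext1_linear to_ext1_linear.
- exact: linear_id.
- by rewrite to_ext1_tens of_ext1_tens ext_val_wedge1.
Qed.

Lemma of_ext1K : cancel of_ext1 to_ext1.
Proof.
apply: tens_lext => [||m xi].
- exact: linear_comp to_ext1_linear of_ext1_linear.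
- exact: linear_id.
- rewrite of_ext1_tens to_ext1_tens; congr (_ ⊗ _).
  by apply: ext_val_inj; rewrite ext_val_wedge1.
Qed.

Lemma cobdryM_bilin p : bilin (fun m (xi : ext_pow g p) =>
  wedgeM (to_ext1 (mu m)) xi + m ⊗ cobdry delta xi).
Proof.
split=> [xi|m] a u v.
  rewrite linearP to_ext1_linear (@wedgeM_bilin _ _).1 (@tens_bilin M _).1.
  by rewrite scalerDr addrACA.
rewrite cobdry_linear (@wedgeM_bilin _ _).2 (@tens_bilin M _).2.
by rewrite scalerDr addrACA.
Qed.

Lemma cobdryM_tens p m (xi : ext_pow g p) :
  cobdryM (m ⊗ xi) = wedgeM (to_ext1 (mu m)) xi + m ⊗ cobdry delta xi.
Proof. exact: (lift_tens _ _ (cobdryM_bilin p)). Qed.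

Lemma cobdryM_linear p : linear (@cobdryM p).
Proof. exact: (lift_linear (cobdryM_bilin p)). Qed.

End Coefficients.

(* Main.v *)
Require Import Defs.
From HB Require Import structures.
From mathcomp Require Import all_boot all_order all_fingroup all_algebra.
From mathcomp Require Import boolp zify.

(** Everything is computed on the operators [lmul Y], left multiplication by Y,
    since M (x) Lambda^* g is generated under them by M (x) Lambda^0 g. One has
    bdry (Y /\ xi) = - sigma Y xi - Y /\ bdry xi and
    cobdry (Y /\ xi) = - delta Y /\ xi - Y /\ cobdry xi.
    Hence, with coefficients, d d (m (x) xi) = (d mu m) /\ xi, where d mu m is the
    defect of the comodule identity at m; and D = d bdry + bdry d satisfies
    D (m (x) Y /\ xi) = Y /\ D (m (x) xi) + C(m, Y) /\ xi, where C(m, Y) is the defect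
    of the bimodule compatibility. Involutivity of g enters in the latter: writing
    delta Y as a sum of tensors A (x) B, the commutator of bdry with left
    multiplication by delta Y is the sum of the A /\ sigma B, without the extra
    term in nabla (delta Y). Finally D (m (x) 1) = sigmabar (mu m) (x) 1. *)

Set Implicit Arguments.
Unset Strict Implicit.
Unset Printing Implicit Defensive.

Import GRing.Theory.
Local Open Scope ring_scope.

Lemma linN (U W : lmodType rat) (h : U -> W) : linear h -> {morph h : u / - u}.
Proof. by move=> hL u; rewrite -scaleN1r (linZ hL) scaleN1r. Qed.

Lemma linB (U W : lmodType rat) (h : U -> W) : linear h -> {morph h : u v / u - v}.
Proof. by move=> hL u v; rewrite (linD hL) (linN hL). Qed.

(* Locked: otherwise unification unfolds it to a scalar multiple of an [mlift]. *)
HB.lock Definition lmul (g : lmodType rat) (Y : g) p (xi : ext_pow g p) : ext_pow g p.+1 :=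
  wedgep (wedge (fun _ : 'I_1 => Y)) xi.
Arguments lmul {g} Y {p} xi.

(** * Left multiplication by a vector on the exterior algebra *)

Section LeftMultiplication.
Variable g : lmodType rat.

Lemma lmul_linear Y p : linear (@lmul g Y p).
Proof. by move=> a u v; rewrite lmul.unlock (@wedgep_bilin g 1 p).2. Qed.

Arguments lmul_linear : clear implicits.

Lemma lmul_linear_l p (xi : ext_pow g p) : linear (fun Y => lmul Y xi).
Proof. by move=> a Y Z; rewrite lmul.unlock wedge1_linear (@wedgep_bilin g 1 p).1. Qed.

Lemma fcons0 p (Y : g) (X : 'I_p -> g) : fcons Y X ord0 = Y.
Proof. by rewrite /fcons unlift_none. Qed.

Lemma fcons_lift p (Y : g) (X : 'I_p -> g) i : fcons Y X (fintype.lift ord0 i) = X i.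
Proof. by rewrite /fcons liftK. Qed.

Lemma fcat_fcons p q (A : g) (X : 'I_p -> g) (Z : 'I_q -> g) :
  fcat (fcons A X) Z = fcons A (fcat X Z) :> ('I_(p + q).+1 -> g).
Proof.
apply/funext => k; case: (unliftP ord0 k) => [j ->|->]; last first.
  rewrite fcons0.
  have -> : ord0 = lshift q (ord0 : 'I_p.+1) by apply: val_inj.
  by rewrite fcatl fcons0.
rewrite fcons_lift -[j]splitK; case: (split j) => l; rewrite /unsplit.
  have -> : fintype.lift ord0 (lshift q l) = lshift q (fintype.lift ord0 l) :> 'I_(p.+1 + q).
    exact: val_inj.
  by rewrite !fcatl fcons_lift.
have -> : fintype.lift ord0 (rshift p l) = rshift p.+1 l by apply: val_inj.
by rewrite !fcatr.
Qed.

Lemma fcat0 q (X : 'I_0 -> g) (Z : 'I_q -> g) : fcat X Z = Z.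
Proof.
apply/funext => k; have -> : k = rshift 0 k by apply: val_inj.
by rewrite fcatr; congr Z; apply: val_inj.
Qed.

Lemma lmul_wedge Y p (X : 'I_p -> g) : lmul Y (wedge X) = wedge (fcons Y X).
Proof.
rewrite lmul.unlock wedgep_wedge.
have -> : (fun _ : 'I_1 => Y) = fcons Y (omit ord0 (fun _ : 'I_1 => Y)).
  by rewrite (fconsK (fun _ : 'I_1 => Y)).
by rewrite fcat_fcons fcat0.
Qed.

Lemma wedge_fcons p (X : 'I_p.+1 -> g) : wedge X = lmul (X ord0) (wedge (omit ord0 X)).
Proof. by rewrite lmul_wedge fconsK. Qed.

Lemma wedgep_lmul Y p q (xi : ext_pow g p) (eta : ext_pow g q) :
  wedgep (lmul Y xi) eta = lmul Y (wedgep xi eta).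
Proof.
move: xi; apply: ext_ext => [||X].
- by move=> a u v; rewrite lmul_linear (@wedgep_bilin g _ _).1.
- by move=> a u v; rewrite (@wedgep_bilin g _ _).1 lmul_linear.
move: eta; apply: ext_ext => [||Z].
- by move=> a u v; rewrite (@wedgep_bilin g _ _).2.
- by move=> a u v; rewrite (@wedgep_bilin g _ _).2 lmul_linear.
by rewrite lmul_wedge !wedgep_wedge lmul_wedge fcat_fcons.
Qed.

Lemma wedge0p q (X : 'I_0 -> g) (eta : ext_pow g q) : wedgep (wedge X) eta = eta.
Proof.
move: eta; apply: ext_ext => [||Z].
- exact: (@wedgep_bilin g 0 q).2.
- exact: linear_id.
- by rewrite wedgep_wedge fcat0.
Qed.

Lemma wedge1E Y (X : 'I_0 -> g) : wedge (fun _ : 'I_1 => Y) = lmul Y (wedge X).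
Proof. by rewrite (wedge_fcons (fun=> Y)); congr (lmul _ (wedge _)); apply/funext => -[]. Qed.

Lemma wedge2E (X : 'I_2 -> g) :
  wedge X = lmul (X ord0) (wedge (fun _ : 'I_1 => X (inord 1))).
Proof.
rewrite wedge_fcons; congr (lmul _ (wedge _)); apply/funext => k.
by rewrite /omit; congr X; apply: val_inj; rewrite ord1 /= inordK.
Qed.

(** On decomposables this is the transposition of the first two entries. *)
Lemma lmulC A B p (xi : ext_pow g p) : lmul A (lmul B xi) = - lmul B (lmul A xi).
Proof.
move: xi; apply: ext_ext => [||X].
- by move=> a u v; rewrite !lmul_linear.
- by move=> a u v; rewrite !lmul_linear opprD scalerN.
rewrite !lmul_wedge.
have := @wedge_tperm g p.+2 (fcons B (fcons A X)) ord0 (fintype.lift ord0 ord0) isT.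
move=> <-; congr wedge; apply/funext => k.
case: tpermP => [->|->|]; rewrite ?fcons0 ?fcons_lift ?fcons0 // => k0 k1.
case: (unliftP ord0 k) => [j ej|//]; rewrite ej !fcons_lift.
case: (unliftP ord0 j) => [l el|ej0]; first by rewrite el !fcons_lift.
by rewrite ej ej0 in k1.
Qed.

(** Elements of even degree are central: A crosses two vectors and the two signs cancel. *)
Lemma wedgep2_lmul (eta : ext_pow g 2) A p (xi : ext_pow g p) :
  wedgep eta (lmul A xi) = lmul A (wedgep eta xi).
Proof.
move: eta; apply: ext_ext => [||X].
- exact: (@wedgep_bilin g _ _).1.
- by move=> a u v; rewrite (@wedgep_bilin g _ _).1 lmul_linear.
rewrite wedge2E (wedge1E _ (fun=> 0)) !(wedgep_lmul, wedge0p).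
by rewrite [in LHS](lmulC _ A) (linN (lmul_linear _ _)) [in LHS](lmulC _ A) opprK.
Qed.

End LeftMultiplication.
Arguments lmul_linear {g} Y p.

(** * The adjoint action and the boundary against left multiplication *)

Section LieOperators.
Variables (g : lmodType rat) (nabla : {linear (g ⊗ g)%type -> g}).

Lemma ext0_ind (P : ext_pow g 0 -> Prop) :
  (forall a, P (a *: wedge (fun=> 0))) -> forall xi, P xi.
Proof.
move=> Pw xi; suff [a ->] : exists a, xi = a *: wedge (fun=> 0) by [].
move: xi; apply: ext_ind => [|a _ _ [b ->] [c ->]|X].
- by exists 0; rewrite scale0r.
- by exists (a * b + c); rewrite scalerDl scalerA.
- by exists 1; rewrite scale1r; congr wedge; apply/funext => -[].
Qed.

Lemma sigma0 Y (xi : ext_pow g 0) : sigma nabla Y xi = 0.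
Proof.
elim/ext0_ind: xi => a.
by rewrite (linZ (@sigma_linear _ _ _ _)) sigma_wedge big_ord0 scaler0.
Qed.

Lemma upd_fcons0 p (Y v : g) (X : 'I_p -> g) : upd (fcons Y X) ord0 v = fcons v X.
Proof.
apply/funext => k; rewrite /upd; case: (unliftP ord0 k) => [j ->|->].
  by rewrite !fcons_lift.
by rewrite eqxx fcons0.
Qed.

Lemma upd_fcons_lift p (Y v : g) (X : 'I_p -> g) i :
  upd (fcons Y X) (fintype.lift ord0 i) v = fcons Y (upd X i v).
Proof.
apply/funext => k; rewrite /upd; case: (unliftP ord0 k) => [j ->|->].
  by rewrite !fcons_lift (inj_eq lift_inj).
by rewrite !fcons0.
Qed.

Lemma omit_fcons0 p (Y : g) (X : 'I_p -> g) : omit ord0 (fcons Y X) = X.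
Proof. by apply/funext => k; rewrite /omit fcons_lift. Qed.

Lemma omit_fcons_lift p (Y : g) (X : 'I_p.+1 -> g) i :
  omit (fintype.lift ord0 i) (fcons Y X) = fcons Y (omit i X).
Proof.
apply/funext => k; rewrite /omit; case: (unliftP ord0 k) => [j ->|->].
  rewrite fcons_lift.
  have -> : fintype.lift (fintype.lift ord0 i) (fintype.lift ord0 j) =
    fintype.lift ord0 (fintype.lift i j) by apply: val_inj; rewrite /= /bump /=; lia.
  by rewrite fcons_lift.
have -> : fintype.lift (fintype.lift ord0 i) ord0 = ord0 :> 'I_p.+2 by apply: val_inj.
by rewrite !fcons0.
Qed.

Lemma sigma_lmul Y A p (xi : ext_pow g p) :
  sigma nabla Y (lmul A xi) = lmul (bracket nabla Y A) xi + lmul A (sigma nabla Y xi).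
Proof.
move: xi; apply: ext_ext => [||X].
- by move=> a u v; rewrite lmul_linear sigma_linear.
- by move=> a u v; rewrite !(lmul_linear, sigma_linear) scalerDr addrACA.
rewrite lmul_wedge !sigma_wedge big_ord_recl fcons0 upd_fcons0 lmul_wedge; congr (_ + _).
rewrite (lin_sum (lmul_linear _ _)); apply: eq_bigr => i _.
by rewrite fcons_lift upd_fcons_lift lmul_wedge.
Qed.

(** Moving the entry of index i to the front takes i transpositions. This turns the terms of [sigma]
    into the shape of those of [bdry]. *)
Lemma wedge_upd p (X : 'I_p.+1 -> g) i v :
  wedge (upd X i v) = (-1) ^+ i *: lmul v (wedge (omit i X)).
Proof.
elim: p X i => [|p IH] X i.
  by rewrite ord1 scale1r lmul_wedge -{1}(fconsK X) upd_fcons0.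
rewrite -{1}(fconsK X); case: (unliftP ord0 i) => [j ->|->]; last first.
  by rewrite upd_fcons0 scale1r lmul_wedge.
rewrite upd_fcons_lift -lmul_wedge IH (linZ (lmul_linear _ _)) lmulC.
by rewrite lift0 exprS mulN1r scaleNr scalerN -{3}(fconsK X) omit_fcons_lift lmul_wedge.
Qed.

(* [lmul A] after [bdry], with [bdry] read as 0 in degree 0. *)
Definition lmul_bdry A p : ext_pow g p -> ext_pow g p :=
  match p with
  | 0 => fun=> 0
  | q.+1 => fun xi => lmul A (bdry nabla xi)
  end.

Hypothesis Lg : is_lie_algebra nabla.

Lemma lmul_bdry_linear A p : linear (@lmul_bdry A p).
Proof.
case: p => [|p]; first exact: linear_zero.
by move=> a u v /=; rewrite bdry_linear // lmul_linear.
Qed.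

(** Cartan's formula: in the boundary of A ∧ X_1 ∧ ... ∧ X_p, the pairs containing A give the action
    of A, and the other pairs give the boundary of the X_i. *)
Lemma bdry_lmul A p (xi : ext_pow g p) :
  bdry nabla (lmul A xi) = - sigma nabla A xi - lmul_bdry A xi.
Proof.
case: p xi => [|p] xi; first by rewrite bdry0 sigma0 !subr0 oppr0.
move: xi; apply: ext_ext => [||X].
- by move=> a u v; rewrite lmul_linear bdry_linear.
- move=> a u v; rewrite lmul_bdry_linear sigma_linear.
  by rewrite !opprD addrACA scalerBr scalerN.
rewrite lmul_wedge bdry_wedge //= big_ord_recl; congr (_ + _).
  rewrite sigma_wedge -sumrN big_mkcond big_ord_recl /= add0r.
  apply: eq_bigr => j _.
  rewrite fcons0 fcons_lift /omit2 omit_fcons_lift.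
  have -> : inord (@ord0 p.+1) = ord0 :> 'I_p.+1 by apply: val_inj; rewrite /= inordK.
  by rewrite omit_fcons0 wedge_upd lmul_wedge add0n exprS mulN1r scaleNr.
(* When xi has degree one there is no pair avoiding A, and [bdry] is zero by definition. *)
case: p X => [|p] X.
  rewrite big1 ?bdry0 ?(lin0 (lmul_linear _ _)) ?oppr0 // => i _.
  rewrite big1 // => j; rewrite lift0 => ij.
  by have := leq_trans ij (leq_ord j).
rewrite bdry_wedge // (lin_sum (lmul_linear _ _)) -sumrN; apply: eq_bigr => i _.
rewrite big_mkcond big_ord_recl /= add0r.
rewrite (lin_sum (lmul_linear _ _)) -sumrN [RHS]big_mkcond; apply: eq_bigr => j _ /=.
rewrite /bump !leq0n !add1n ltnS; case: ifP => // ij.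
rewrite !fcons_lift /omit2 omit_fcons_lift.
have -> : inord (i.+1) = fintype.lift ord0 (inord i : 'I_p.+1).
  by apply: val_inj; rewrite /= /bump !inordK ?add1n //; have := ltn_ord j; lia.
(* Shifting both indices by one preserves the sign; the minus comes from moving A in front of the
   bracket. *)
rewrite omit_fcons_lift -!lmul_wedge lmulC (linZ (lmul_linear _ _)).
by rewrite addSn addnS !exprS !mulN1r opprK scalerN.
Qed.
End LieOperators.

(** * The coboundary against left multiplication *)

Section CoLieOperators.
Variables (g : lmodType rat) (delta : {linear g -> ext_pow g 2}).

(** The entry A gives the first term. In the others the index shift changes the sign, while A
    crosses the cobracket freely, this having degree two. *)
Lemma cobdry_lmul A p (xi : ext_pow g p) :
  cobdry delta (lmul A xi) = - wedgep (delta A) xi - lmul A (cobdry delta xi).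
Proof.
move: xi; apply: ext_ext => [||X].
- by move=> a u v; rewrite lmul_linear cobdry_linear.
- move=> a u v; rewrite (@wedgep_bilin g _ _).2 cobdry_linear lmul_linear.
  by rewrite !opprD addrACA scalerBr scalerN.
rewrite lmul_wedge cobdry_wedge big_ord_recl fcons0 omit_fcons0 expr1 scaleN1r; congr (_ + _).
case: p X => [|p] X; first by rewrite big_ord0 cobdry0 (lin0 (lmul_linear _ _)) oppr0.
rewrite cobdry_wedge (lin_sum (lmul_linear _ _)) -sumrN; apply: eq_bigr => i _.
rewrite (linZ (lmul_linear _ _)) fcons_lift omit_fcons_lift -lmul_wedge wedgep2_lmul.
by rewrite lift0 exprS mulN1r scaleNr.
Qed.

Lemma wedgep2_0 (eta : ext_pow g 2) (X : 'I_0 -> g) : wedgep eta (wedge X) = eta :> ext_pow g 2.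
Proof.
move: eta; apply: ext_ext => [||Z].
- exact: (@wedgep_bilin g 2 0).1.
- exact: linear_id.
by rewrite wedge2E (wedge1E _ X) !wedgep_lmul wedge0p.
Qed.

(** The Leibniz rule for an odd derivation, without a sign because [eta] has even degree. *)
Lemma cobdry_wedgep2 (eta : ext_pow g 2) p (xi : ext_pow g p) :
  cobdry delta (wedgep eta xi) = wedgep (cobdry delta eta) xi + wedgep eta (cobdry delta xi).
Proof.
move: eta; apply: ext_ext => [||X].
- by move=> a u v; rewrite (@wedgep_bilin g _ _).1 cobdry_linear.
- move=> a u v; rewrite cobdry_linear !(@wedgep_bilin g _ _).1.
  by rewrite scalerDr addrACA.
rewrite wedge2E (wedge1E _ (fun=> 0)); set A := X ord0; set B := X (inord 1).
rewrite !(wedgep_lmul, wedge0p) !cobdry_lmul cobdry0.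
rewrite !wedgep2_lmul !wedgep2_0 (lin0 (lmul_linear _ _)) subr0.
rewrite !(linB (lmul_linear _ _)) !(linN (lmul_linear _ _)).
rewrite (linB ((@wedgep_bilin g _ _).1 _)) !(linN ((@wedgep_bilin g _ _).1 _)).
by rewrite !wedgep_lmul !opprK opprD !opprK addrA.
Qed.

(** * Low-degree tensor expansions and the coJacobi identity *)

Lemma sum_perm_lift (U : lmodType rat) p (F : 'S_p.+1 -> U) :
  \sum_s F s = \sum_i \sum_(s : 'S_p) F (lift_perm ord0 i s).
Proof.
rewrite (partition_big (fun s : 'S_p.+1 => s ord0) xpredT) //=.
apply: eq_bigr => i _.
have inj : injective (@lift_perm p ord0 i).
  move=> s t e; apply/permP => k; apply: (@lift_inj _ i).
  by rewrite -!(@lift_perm_lift _ ord0) e.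
rewrite -(big_image _ _ (@lift_perm p ord0 i) predT) /= big_uniq ?map_inj_uniq
  -?enumT ?enum_uniq //=.
apply: eq_bigl => s; apply/eqP/imageP => [<-|[t _ ->]]; last by rewrite lift_perm_id.
by have [t et] := lift_permP s ord0; exists t.
Qed.

(** The analogue of Laplace expansion: permutations are grouped by the entry they put in the first
    tensor factor. *)
Lemma alt_rec p (X : 'I_p.+2 -> g) :
  alt X = \sum_(i < p.+2) (-1) ^+ i *: (X i ⊗ alt (omit i X)) :> (g ⊗ tpow g p.+1)%type.
Proof.
rewrite /alt sum_perm_lift; apply: eq_bigr => i _.
rewrite (lin_sum ((@tens_bilin _ _).2 _)) scaler_sumr; apply: eq_bigr => s _.
rewrite pureS lift_perm_id odd_lift_perm !signr_addb (signr_odd _ i) mul1r.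
rewrite (linZ ((@tens_bilin _ _).2 _)) scalerA; congr (_ *: (_ ⊗ pure _)).
by apply/funext => k; rewrite /omit lift_perm_lift.
Qed.

Lemma ext_val_lmul1 A B :
  ext_val (lmul A (wedge (fun _ : 'I_1 => B))) = A ⊗ B - B ⊗ A :> (g ⊗ g)%type.
Proof.
rewrite lmul_wedge [LHS]alt_rec !big_ord_recl big_ord0 addr0 scale1r scaleN1r.
rewrite fcons0 omit_fcons0 fcons_lift.
have -> : omit (fintype.lift ord0 ord0) (fcons A (fun _ : 'I_1 => B)) = fun=> A.
  by apply/funext => k; rewrite (ord1 k) omit_fcons_lift fcons0.
by congr (_ ⊗ _ - _ ⊗ _); exact: ext_val_wedge1.
Qed.

Lemma ext_val_lmul2 A B C :
  ext_val (lmul A (lmul B (wedge (fun _ : 'I_1 => C)))) =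
  A ⊗ (B ⊗ C - C ⊗ B) - B ⊗ (A ⊗ C - C ⊗ A) + C ⊗ (A ⊗ B - B ⊗ A) :> (g ⊗ (g ⊗ g))%type.
Proof.
rewrite 2!lmul_wedge [LHS]alt_rec !big_ord_recl big_ord0 addr0 scale1r scaleN1r.
rewrite fcons0 omit_fcons0 fcons_lift fcons0 !omit_fcons_lift omit_fcons0.
rewrite !fcons_lift.
have -> : omit ord0 (fun _ : 'I_1 => C) = (fun=> 0) by apply/funext => -[].
have e (D : g) : fcons D (fun=> 0) = (fun _ : 'I_1 => D).
  by apply/funext => k; rewrite (ord1 k) fcons0.
rewrite e addrA; congr (_ ⊗ _ - _ ⊗ _ + _).
- by rewrite -ext_val_lmul1 lmul_wedge.
- by rewrite -ext_val_lmul1 lmul_wedge.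
by rewrite sqrrN expr1n scale1r -ext_val_lmul1 lmul_wedge.
Qed.

Lemma cyc_tens (u v w : g) : cyc (u ⊗ (v ⊗ w)) = w ⊗ (u ⊗ v).
Proof. by rewrite /cyc assocl_tens flip_tens. Qed.

Lemma cyc_linear : linear (@cyc g).
Proof. by move=> a u v; rewrite /cyc assocl_linear flip_linear. Qed.

Lemma cyc_sum_linear : linear (@cyc_sum g).
Proof.
move=> a u v; rewrite /cyc_sum !cyc_linear !scalerDr.
by rewrite (addrACA (a *: u) v) (addrACA (a *: u + _)).
Qed.

(** Each permutation of three letters is uniquely a rotation composed with a permutation of the
    first two; [eta] is already antisymmetric, so only the rotations remain. *)
Lemma ext_val_wedgep21 (eta : ext_pow g 2) B :
  ext_val (wedgep eta (wedge (fun _ : 'I_1 => B))) =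
  cyc_sum (assocr ((ext_val eta : (g ⊗ g)%type) ⊗ B)).
Proof.
move: eta; apply: ext_ext => [||X].
- by move=> a u v; rewrite (@wedgep_bilin g _ _).1 ext_val_linear.
- by move=> a u v; rewrite ext_val_linear (@tens_bilin _ _).1 assocr_linear cyc_sum_linear.
rewrite wedge2E ext_val_lmul1 (wedge1E _ (fun=> 0)) !wedgep_lmul wedge0p.
set C := X ord0; set D := X (inord 1).
rewrite (linB ((@tens_bilin _ _).1 _)) (linB (@assocr_linear _ _ _)) !assocr_tens.
rewrite (linB cyc_sum_linear) /cyc_sum !cyc_tens ext_val_lmul2.
rewrite !(linB ((@tens_bilin _ _).2 _)) !opprB.
by rewrite !opprD (AC (2*2*2) (1*5*3 * (4*6*2))).
Qed.

(** Links the coJacobi identity, stated on tensors, to the square of [cobdry]: for [eta] = A ∧ B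
    both sides are - delta A ∧ B + delta B ∧ A. *)
Lemma ext_val_cobdry2 (eta : ext_pow g 2) :
  ext_val (cobdry delta eta) =
  - cyc_sum (assocr (tmap (delta2 delta) id (ext_val eta : (g ⊗ g)%type))).
Proof.
have d2L : linear (delta2 delta) by move=> a u v; rewrite /delta2 linearP ext_val_linear.
have mL : linear (tmap (delta2 delta) (@id g)) by exact: tmap_linear d2L (@linear_id g).
move: eta; apply: ext_ext => [||X].
- by move=> a u v; rewrite cobdry_linear ext_val_linear.
- by move=> a u v; rewrite ext_val_linear mL assocr_linear cyc_sum_linear opprD scalerN.
rewrite wedge2E ext_val_lmul1 (linB mL) !tmap_tens //.
set A := X ord0; set B := X (inord 1).
rewrite (linB (@assocr_linear _ _ _)) (linB cyc_sum_linear).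
rewrite /delta2 -!ext_val_wedgep21 opprB -(linB (@ext_val_linear g 3)); congr ext_val.
rewrite cobdry_lmul (wedge1E _ (fun=> 0)) cobdry_lmul cobdry0 wedgep2_0.
rewrite (lin0 (lmul_linear _ _)) subr0 (linN (lmul_linear _ _)) opprK addrC.
by rewrite (wedge1E _ (fun=> 0)) [X in _ = X - _]wedgep2_lmul wedgep2_0.
Qed.

Lemma cobdry_delta X :
  (forall X, cyc_sum (assocr (tmap (delta2 delta) id (delta2 delta X))) = 0) ->
  cobdry delta (delta X) = 0.
Proof.
move=> cJ; apply: ext_val_inj.
by rewrite ext_val_cobdry2 cJ oppr0 (lin0 (@ext_val_linear g 3)).
Qed.

(** By induction on the degree: on A ∧ xi the two terms delta A ∧ d xi cancel, and what is left
    contains d (delta A) or d (d xi). *)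
Lemma cobdry_cobdry p (xi : ext_pow g p) :
  (forall X, cyc_sum (assocr (tmap (delta2 delta) id (delta2 delta X))) = 0) ->
  cobdry delta (cobdry delta xi) = 0.
Proof.
move=> cJ; elim: p xi => [|p IH] xi; first by rewrite cobdry0 (lin0 (@cobdry_linear _ _ _)).
move: xi; apply: (@ext_ext g p.+1 _ _ (fun=> 0)) => [||X].
- by move=> a u v; rewrite !cobdry_linear.
- exact: linear_zero.
rewrite wedge_fcons cobdry_lmul (linB (@cobdry_linear _ _ _)) (linN (@cobdry_linear _ _ _)).
rewrite cobdry_lmul cobdry_wedgep2 IH (lin0 (lmul_linear _ _)) cobdry_delta // subr0.
by rewrite (bilin0l (@wedgep_bilin _ _ _)) add0r opprK addNr.
Qed.

End CoLieOperators.

(** * The commutator of the adjoint action with the coboundary *)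

Section SigmaCobdry.
Variables (g : lmodType rat) (nabla : {linear (g ⊗ g)%type -> g}).
Variable (delta : {linear g -> ext_pow g 2}).

Lemma ext2_ext (U : lmodType rat) (h k : ext_pow g 2 -> U) : linear h -> linear k ->
  (forall A B, h (lmul A (wedge (fun _ : 'I_1 => B))) = k (lmul A (wedge (fun _ : 'I_1 => B)))) ->
  h =1 k.
Proof. by move=> hL kL hk; apply: ext_ext => // X; rewrite wedge2E. Qed.

Lemma wedgep2E A B p (xi : ext_pow g p) :
  wedgep (lmul A (wedge (fun _ : 'I_1 => B))) xi = lmul A (lmul B xi).
Proof. by rewrite (wedge1E _ (fun=> 0)) !wedgep_lmul wedge0p. Qed.

Definition lmul_sigma (t : g ⊗ g) p (xi : ext_pow g p) : ext_pow g p.+1 :=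
  Defs.lift (fun A B => lmul A (sigma nabla B xi)) t.

Lemma lmul_sigma_bilin p (xi : ext_pow g p) : bilin (fun A B => lmul A (sigma nabla B xi)).
Proof.
by split=> [B|A] a u v; rewrite ?lmul_linear_l // sigma_linear_l lmul_linear.
Qed.

Lemma lmul_sigma_tens A B p (xi : ext_pow g p) :
  lmul_sigma (A ⊗ B) xi = lmul A (sigma nabla B xi).
Proof. exact: (lift_tens _ _ (lmul_sigma_bilin xi)). Qed.

Lemma lmul_sigma_linear p (xi : ext_pow g p) : linear (fun t => lmul_sigma t xi).
Proof. exact: (lift_linear (lmul_sigma_bilin xi)). Qed.

Lemma lmul_sigma_linear_r t p : linear (@lmul_sigma t p).
Proof.
move=> a u v; rewrite /lmul_sigma -lift_combl; apply: eq_lift => A B.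
by rewrite sigma_linear lmul_linear.
Qed.

(** For [eta] = A ∧ B the action on X produces A ∧ [B, X] - B ∧ [A, X], which is the negative of the
    action of X on [eta]. This is the recursion used in [sigma_cobdry]. *)
Lemma lmul_sigma_lmul (eta : ext_pow g 2) X p (xi : ext_pow g p) :
  is_lie_algebra nabla ->
  lmul_sigma (ext_val eta) (lmul X xi) =
  - wedgep (sigma nabla X eta) xi - lmul X (lmul_sigma (ext_val eta) xi).
Proof.
move=> Lg; move: eta; apply: ext2_ext => [||A B].
- by move=> a u v; rewrite ext_val_linear lmul_sigma_linear.
- move=> a u v; rewrite ext_val_linear !lmul_sigma_linear sigma_linear lmul_linear.
  by rewrite (@wedgep_bilin _ _ _).1 !opprD addrACA scalerBr scalerN.
rewrite ext_val_lmul1 !(linB (lmul_sigma_linear _)) !lmul_sigma_tens !sigma_lmul.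
rewrite (wedge1E _ (fun=> 0)) sigma_lmul sigma0 (lin0 (lmul_linear _ _)) addr0.
rewrite (linD ((@wedgep_bilin _ _ _).1 _)) !wedgep_lmul wedge0p.
rewrite !(linD (lmul_linear _ _)).
rewrite (bracketC B X Lg) (bracketC A X Lg).
rewrite !(linN (lmul_linear_l _)) !(linN (lmul_linear _ _)).
rewrite (lmulC A X) (lmulC B X) (lmulC (bracket nabla X A) B).
by rewrite !opprD !opprK (AC (2*2) (3*1*(2*4))).
Qed.

Lemma sigma_wedgep2 Y (eta : ext_pow g 2) p (xi : ext_pow g p) :
  sigma nabla Y (wedgep eta xi) = wedgep (sigma nabla Y eta) xi + wedgep eta (sigma nabla Y xi).
Proof.
move: eta; apply: ext2_ext => [||A B].
- by move=> a u v; rewrite (@wedgep_bilin _ _ _).1 sigma_linear.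
- move=> a u v; rewrite sigma_linear !(@wedgep_bilin _ _ _).1 scalerDr.
  by rewrite addrACA.
rewrite !wedgep2E !sigma_lmul (wedge1E _ (fun=> 0)) sigma_lmul sigma0.
rewrite (lin0 (lmul_linear _ _)) addr0 !(linD (lmul_linear _ _)).
rewrite (linD ((@wedgep_bilin _ _ _).1 _)) !wedgep_lmul !wedge0p.
by rewrite addrA.
Qed.

Hypothesis Lg : is_lie_algebra nabla.
Hypothesis compat : forall X Y, delta (bracket nabla X Y) =
  sigma nabla X (delta Y) - sigma nabla Y (delta X).

(** Both sides vanish in degree 0 and satisfy the same recursion under left multiplication by X;
    compatibility of the cobracket with the bracket provides it for the left side. *)
Lemma sigma_cobdry Y p (xi : ext_pow g p) :
  sigma nabla Y (cobdry delta xi) - cobdry delta (sigma nabla Y xi) =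
  lmul_sigma (delta2 delta Y) xi.
Proof.
elim: p xi => [|p IH] xi.
  rewrite sigma0 cobdry0 (lin0 (@sigma_linear _ _ _ _)) (lin0 (@cobdry_linear _ _ _)) subr0.
  rewrite /lmul_sigma (@eq_lift _ _ _ _ (fun A B => 0)) ?/Defs.lift ?/bsum ?big1 // => A B.
  by rewrite sigma0 (lin0 (lmul_linear _ _)).
move: xi; apply: ext_ext => [||X].
- move=> a u v; rewrite !(sigma_linear, cobdry_linear) opprD addrACA.
  by rewrite scalerBr.
- exact: lmul_sigma_linear_r.
rewrite wedge_fcons; move: (wedge _) (X _) => {}xi {}X.
rewrite /delta2 lmul_sigma_lmul // -/(delta2 delta Y) -IH.
rewrite sigma_lmul (linD (@cobdry_linear _ _ _)) !cobdry_lmul.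
rewrite (linB (@sigma_linear _ _ _ _)) (linN (@sigma_linear _ _ _ _)).
rewrite sigma_wedgep2 sigma_lmul compat (linB (lmul_linear _ _)).
rewrite (linB ((@wedgep_bilin _ _ _).1 _)).
set a := wedgep (sigma _ _ _) _; set b := wedgep (delta X) _; set c := lmul (bracket _ _ _) _.
(* The terms [a], [b] and [c] each occur twice with opposite signs. *)
by rewrite !opprD !opprK (AC (2*2*(3*2)) ((1*5)*(2*8)*(3*7)*(6*(4*9)))) /= !addNr !add0r.
Qed.
End SigmaCobdry.

(** * The operators with coefficients in M *)

Section CoefficientOperators.
Variables (g : lmodType rat) (nabla : {linear (g ⊗ g)%type -> g}).
Variable (delta : {linear g -> ext_pow g 2}).
Variables (M : lmodType rat) (act : {linear (g ⊗ M)%type -> M}).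
Variable (mu : {linear M -> (M ⊗ g)%type}).

Local Notation dM := (cobdryM delta mu).
Local Notation bM := (bdryM nabla act).
Local Notation sM := (sigmaM nabla act).

Lemma tensM_linear_l (V : lmodType rat) (v : V) : linear (fun m : M => m ⊗ v).
Proof. exact: (@tens_bilin M V).1. Qed.

Lemma tensM_linear_r (V : lmodType rat) (m : M) : linear (fun v : V => m ⊗ v).
Proof. exact: (@tens_bilin M V).2. Qed.

Lemma tens_wedge_ext p (U : lmodType rat) (h k : M ⊗ ext_pow g p -> U) :
  linear h -> linear k -> (forall m X, h (m ⊗ wedge X) = k (m ⊗ wedge X)) -> h =1 k.
Proof.
move=> hL kL hk; apply: tens_lext => // m; apply: ext_ext => // a u v.
  by rewrite tensM_linear_r hL.
by rewrite tensM_linear_r kL.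
Qed.

Definition lmulM Y p (u : M ⊗ ext_pow g p) : M ⊗ ext_pow g p.+1 := tmap id (lmul Y) u.

Lemma lmulM_tens Y m p (xi : ext_pow g p) : lmulM Y (m ⊗ xi) = m ⊗ lmul Y xi.
Proof. exact: tmap_tens (@linear_id M) (lmul_linear Y p). Qed.

Lemma lmulM_linear Y p : linear (@lmulM Y p).
Proof. exact: tmap_linear (@linear_id M) (lmul_linear Y p). Qed.

Lemma lmulM_linear_l p (u : M ⊗ ext_pow g p) : linear (fun Y => lmulM Y u).
Proof.
move=> a Y Z; rewrite /lmulM /tmap -lift_combl; apply: eq_lift => m xi.
by rewrite lmul_linear_l tensM_linear_r.
Qed.

Definition wedge2M (eta : ext_pow g 2) p (u : M ⊗ ext_pow g p) : M ⊗ ext_pow g p.+2 :=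
  tmap id (wedgep eta) u.

Lemma wedge2M_tens eta m p (xi : ext_pow g p) : wedge2M eta (m ⊗ xi) = m ⊗ wedgep eta xi.
Proof. exact: tmap_tens (@linear_id M) ((@wedgep_bilin g 2 p).2 eta). Qed.

Lemma wedge2M_linear eta p : linear (@wedge2M eta p).
Proof. exact: tmap_linear (@linear_id M) ((@wedgep_bilin g 2 p).2 eta). Qed.

Lemma wedge2M_linear_l p (u : M ⊗ ext_pow g p) : linear (fun eta => wedge2M eta u).
Proof.
move=> a Y Z; rewrite /wedge2M /tmap -lift_combl; apply: eq_lift => m xi.
by rewrite (@wedgep_bilin _ _ _).1 tensM_linear_r.
Qed.

(** Takes [t] in M ⊗ g, where [mu] has its values, and hides the passage to Λ^1. *)
Definition wedge1M (t : M ⊗ g) p (xi : ext_pow g p) : M ⊗ ext_pow g p.+1 :=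
  wedgeM (to_ext1 t) xi.

Lemma wedge1M_linear_l p (xi : ext_pow g p) : linear (fun t => wedge1M t xi).
Proof. by move=> a u v; rewrite /wedge1M to_ext1_linear (@wedgeM_bilin _ _ _ _).1. Qed.

Lemma wedge1M_tens m X p (xi : ext_pow g p) : wedge1M (m ⊗ X) xi = m ⊗ lmul X xi.
Proof. by rewrite /wedge1M to_ext1_tens [LHS]wedgeM_tens lmul.unlock. Qed.

Lemma cobdryM_tensE m p (xi : ext_pow g p) :
  dM (m ⊗ xi) = wedge1M (mu m) xi + m ⊗ cobdry delta xi.
Proof. exact: cobdryM_tens. Qed.

Lemma wedge1M_lmul t Y p (xi : ext_pow g p) : wedge1M t (lmul Y xi) = - lmulM Y (wedge1M t xi).
Proof.
move: t; apply: tens_lext => [||m X].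
- exact: wedge1M_linear_l.
- by move=> a u v; rewrite wedge1M_linear_l lmulM_linear opprD scalerN.
by rewrite !wedge1M_tens lmulM_tens lmulC (linN (@tensM_linear_r _ _)).
Qed.

(** The coefficient part inserts the vector of [mu m] in front of Y; moving Y to the front gives the
    same sign as in [cobdry_lmul]. *)
Lemma cobdryM_lmulM Y p (u : M ⊗ ext_pow g p) :
  dM (lmulM Y u) = - lmulM Y (dM u) - wedge2M (delta Y) u.
Proof.
move: u; apply: tens_lext => [||m xi].
- by move=> a u v; rewrite lmulM_linear cobdryM_linear.
- move=> a u v; rewrite cobdryM_linear lmulM_linear wedge2M_linear.
  by rewrite !opprD addrACA scalerBr scalerN.
rewrite lmulM_tens !cobdryM_tensE wedge1M_lmul cobdry_lmul (linD (@lmulM_linear _ _)) lmulM_tens.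
rewrite wedge2M_tens (linB (@tensM_linear_r _ _)) (linN (@tensM_linear_r _ _)) opprD.
by rewrite addrA addrAC.
Qed.

Lemma sigmaM_lmulM Y A p (u : M ⊗ ext_pow g p) :
  sM Y (lmulM A u) = lmulM (bracket nabla Y A) u + lmulM A (sM Y u).
Proof.
move: u; apply: tens_lext => [||m xi].
- by move=> a u v; rewrite lmulM_linear sigmaM_linear.
- by move=> a u v; rewrite sigmaM_linear !lmulM_linear scalerDr addrACA.
rewrite !lmulM_tens !sigmaM_tens sigma_lmul (linD (@lmulM_linear _ _)) !lmulM_tens.
by rewrite (linD (@tensM_linear_r _ _)) addrCA.
Qed.

Lemma sigmaM_linear_l p (u : M ⊗ ext_pow g p) : linear (fun Y => sM Y u).
Proof.
move=> a Y Z; rewrite /sigmaM -lift_combl; apply: eq_lift => m xi.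
rewrite (act_bilin act).1 sigma_linear_l tensM_linear_l tensM_linear_r.
by rewrite scalerDr addrACA.
Qed.

Definition lmulM_sigma (t : g ⊗ g) p (u : M ⊗ ext_pow g p) : M ⊗ ext_pow g p.+1 :=
  Defs.lift (fun A B => lmulM A (sM B u)) t.

Lemma lmulM_sigma_bilin p (u : M ⊗ ext_pow g p) : bilin (fun A B => lmulM A (sM B u)).
Proof.
by split=> [B|A] a x y; rewrite ?lmulM_linear_l // sigmaM_linear_l lmulM_linear.
Qed.

Lemma lmulM_sigma_tens A B p (u : M ⊗ ext_pow g p) :
  lmulM_sigma (A ⊗ B) u = lmulM A (sM B u).
Proof. exact: (lift_tens _ _ (lmulM_sigma_bilin u)). Qed.

Lemma lmulM_sigma_linear_l p (u : M ⊗ ext_pow g p) : linear (fun t => lmulM_sigma t u).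
Proof. exact: (lift_linear (lmulM_sigma_bilin u)). Qed.

(** On the left the second tensor factor of [eta] acts on m, on the right [sigmabar] uses the first;
    the sign in [sigmabar] and the antisymmetry of [eta] compensate. *)
Lemma lmulM_sigma_ext_val (eta : ext_pow g 2) m p (xi : ext_pow g p) :
  lmulM_sigma (ext_val eta) (m ⊗ xi) =
  wedge1M (tmap (sigmabar act) id (assocl (m ⊗ (ext_val eta : (g ⊗ g)%type)))) xi
  + m ⊗ lmul_sigma nabla (ext_val eta) xi.
Proof.
have sL : linear (tmap (sigmabar act) (@id g)) by apply: tmap_linear => //; exact: sigmabar_linear.
move: eta; apply: ext2_ext => [||A B].
- by move=> a u v; rewrite ext_val_linear lmulM_sigma_linear_l.
- move=> a u v; rewrite ext_val_linear tensM_linear_r assocl_linear sL wedge1M_linear_l.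
  by rewrite lmul_sigma_linear tensM_linear_r scalerDr addrACA.
rewrite ext_val_lmul1 (linB (lmulM_sigma_linear_l _)) !lmulM_sigma_tens !sigmaM_tens.
rewrite (linB (@tensM_linear_r _ _)) (linB (@assocl_linear _ _ _)) !assocl_tens (linB sL).
rewrite !tmap_tens //; try exact: sigmabar_linear.
rewrite !sigmabar_tens (linB (wedge1M_linear_l _)) !(linN (@tensM_linear_l _ _)).
rewrite !(linN (wedge1M_linear_l _)) !wedge1M_tens (linB (lmul_sigma_linear _ _)).
rewrite !lmul_sigma_tens !(linD (@lmulM_linear _ _)) !lmulM_tens (linB (@tensM_linear_r _ _)).
by rewrite opprD opprK addrACA; congr (_ + _); rewrite addrC.
Qed.

Definition compat_defect m Y : M ⊗ g :=
  of_ext1 (sM Y (to_ext1 (mu m))) - mu (act (Y ⊗ m))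
  - tmap (sigmabar act) id (assocl (tmap id (delta2 delta) (m ⊗ Y))).

Lemma sigmaM_wedge1M Y t p (xi : ext_pow g p) :
  sM Y (wedge1M t xi) =
  wedge1M (of_ext1 (sM Y (to_ext1 t))) xi + wedge1M t (sigma nabla Y xi).
Proof.
move: t; apply: tens_lext => [||m X].
- by move=> a u v; rewrite wedge1M_linear_l sigmaM_linear.
- move=> a u v; rewrite to_ext1_linear sigmaM_linear of_ext1_linear !wedge1M_linear_l.
  by rewrite scalerDr addrACA.
rewrite to_ext1_tens sigmaM_tens (wedge1E X (fun=> 0)) sigma_lmul sigma0.
rewrite (lin0 (lmul_linear _ _)) addr0 -!(wedge1E _ (fun=> 0)).
rewrite (linD (@of_ext1_linear _ _)) !of_ext1_tens !ext_val_wedge1.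
rewrite (linD (wedge1M_linear_l _)) !wedge1M_tens sigmaM_tens sigma_lmul.
by rewrite (linD (@tensM_linear_r _ _)) addrA.
Qed.

(** * The anticommutator of [d] and the boundary *)

Section LieBialgebra.
Hypothesis Hg : involutive_lie_bialgebra nabla delta.
Let Lg := ilb_lie Hg.

(** The commutator on the exterior factor is known from [sigma_cobdry], so only the terms where [mu]
    or the action meets m survive. *)
Lemma sigmaM_cobdryM Y m p (xi : ext_pow g p) :
  sM Y (dM (m ⊗ xi)) - dM (sM Y (m ⊗ xi)) - lmulM_sigma (delta2 delta Y) (m ⊗ xi) =
  wedge1M (compat_defect m Y) xi.
Proof.
rewrite lmulM_sigma_ext_val -/(delta2 delta Y) -(sigma_cobdry Lg (ilb_compat Hg)).
rewrite cobdryM_tensE sigmaM_tens (linD (@sigmaM_linear _ _ _ _ _ _)).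
rewrite (linD (@cobdryM_linear _ _ _ _ _)).
rewrite !cobdryM_tensE sigmaM_wedge1M sigmaM_tens /compat_defect tmap_tens //; last first.
  by move=> a u v; rewrite /delta2 linearP ext_val_linear.
rewrite !(linB (wedge1M_linear_l _)) (linB (@tensM_linear_r _ _)).
set a := wedge1M (of_ext1 _) _; set b := wedge1M (mu m) _; set c := _ ⊗ cobdry delta xi.
set d := m ⊗ _; set e := wedge1M (mu _) _; set f := m ⊗ _; set h := wedge1M _ xi.
(* The first group is the defect; all other summands cancel in pairs. *)
rewrite !opprD opprK (AC ((2*2)*(2*2)*(1*2)) ((1*5*9)*((2*7)*((3*6)*((4*10)*(11*8)))))) /=.
by rewrite !subrr !addr0.
Qed.

(* [lmulM Y] after [bdryM], with [bdryM] read as 0 in degree 0. *)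
Definition lmulM_bdry Y p : M ⊗ ext_pow g p -> M ⊗ ext_pow g p :=
  match p with 0 => fun=> 0 | q.+1 => fun u => lmulM Y (bM u) end.

Definition wedge2M_bdry eta p : M ⊗ ext_pow g p -> M ⊗ ext_pow g p.+1 :=
  match p with 0 => fun=> 0 | q.+1 => fun u => wedge2M eta (bM u) end.

Lemma lmulM_bdry_linear Y p : linear (@lmulM_bdry Y p).
Proof.
case: p => [|p]; first exact: linear_zero.
by move=> a u v /=; rewrite (bdryM_linear _ Lg) lmulM_linear.
Qed.

Lemma wedge2M_bdry_linear_l p (u : M ⊗ ext_pow g p) : linear (fun eta => wedge2M_bdry eta u).
Proof. by case: p u => [|p] u; [exact: linear_zero | exact: wedge2M_linear_l]. Qed.

Lemma bdryM_lmulM Y p (u : M ⊗ ext_pow g p) : bM (lmulM Y u) = - sM Y u - lmulM_bdry Y u.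
Proof.
move: u; apply: tens_wedge_ext => [||m X].
- by move=> a u v; rewrite lmulM_linear (bdryM_linear _ Lg).
- move=> a u v; rewrite sigmaM_linear lmulM_bdry_linear.
  by rewrite !opprD addrACA scalerBr scalerN.
rewrite lmulM_tens bdryM_tens // sigmaM_tens bdry_lmul //.
rewrite (linB (@tensM_linear_r _ _)) (linN (@tensM_linear_r _ _)) opprD addrA.
rewrite addrAC [RHS]addrAC; congr (_ - _).
rewrite lmul_wedge Gamma_wedge big_ord_recl fcons0 omit_fcons0 expr1 scaleN1r -addrA.
congr (_ + _); case: p X => [|p] X /=.
  by rewrite big_ord0 (lin0 (@tensM_linear_r _ _)) subr0 oppr0.
rewrite bdryM_tens // (linD (@lmulM_linear _ _)) lmulM_tens opprD; congr (_ - _).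
rewrite Gamma_wedge (lin_sum (@lmulM_linear _ _)) -sumrN; apply: eq_bigr => i _.
rewrite fcons_lift omit_fcons_lift -lmul_wedge -lmulM_tens (linZ (@lmulM_linear _ _)).
by rewrite /bump leq0n add1n exprS mulN1r scaleNr.
Qed.

(** Two applications of [bdryM_lmulM]. For [eta] = A ∧ B they produce [A, B] once, whereas [nabla]
    of the tensor A ⊗ B - B ⊗ A is 2 [A, B], hence the factor one half. *)
Lemma bdryM_wedge2M (eta : ext_pow g 2) p (u : M ⊗ ext_pow g p) :
  bM (wedge2M eta u) = wedge2M_bdry eta u + lmulM_sigma (ext_val eta) u
    - 2%:R^-1 *: lmulM (nabla (ext_val eta)) u.
Proof.
move: eta; apply: ext2_ext => [||A B].
- by move=> a x y; rewrite wedge2M_linear_l (bdryM_linear _ Lg).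
- move=> a x y; rewrite wedge2M_bdry_linear_l ext_val_linear lmulM_sigma_linear_l.
  rewrite linearP lmulM_linear_l !scalerDr opprD.
  by rewrite scalerN !scalerA (mulrC a) (AC (2*2*2) (1*3*5*(2*4*6))).
have wE q (v : M ⊗ ext_pow g q) :
    wedge2M (lmul A (wedge (fun _ : 'I_1 => B))) v = lmulM A (lmulM B v).
  move: v; apply: tens_lext => [||m xi].
  - exact: wedge2M_linear.
  - by move=> a x y; rewrite !lmulM_linear.
  by rewrite wedge2M_tens wedgep2E !lmulM_tens.
have -> : wedge2M_bdry (lmul A (wedge (fun _ : 'I_1 => B))) u = lmulM A (lmulM_bdry B u).
  by case: (p) u => [|q] u /=; rewrite ?wE // (lin0 (@lmulM_linear _ _)).
rewrite wE !bdryM_lmulM /= bdryM_lmulM sigmaM_lmulM ext_val_lmul1 (linB (lmulM_sigma_linear_l _)).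
rewrite !lmulM_sigma_tens linearB /= -/(bracket nabla A B) -/(bracket nabla B A).
rewrite (bracketC B A Lg) opprK -mulr2n -scaler_nat (linZ (lmulM_linear_l _)).
rewrite scalerA mulVf // scale1r (linB (@lmulM_linear _ _)) (linN (@lmulM_linear _ _)).
by rewrite !opprD !opprK (AC (2*2) ((4*(3*2))*1)).
Qed.

(** One family over all degrees, so that vanishing can be proved by induction on the degree. *)
Definition anticomm p : M ⊗ ext_pow g p -> M ⊗ ext_pow g p :=
  match p with
  | 0 => fun u => bM (dM u)
  | q.+1 => fun u => dM (bM u) + bM (dM u)
  end.

Lemma anticomm_linear p : linear (@anticomm p).
Proof.
case: p => [|p] a u v /=; first by rewrite cobdryM_linear (bdryM_linear _ Lg).
by rewrite !(cobdryM_linear, bdryM_linear _ Lg) scalerDr addrACA.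
Qed.

Lemma anticomm_lmulM Y m p (xi : ext_pow g p) :
  anticomm (lmulM Y (m ⊗ xi)) = lmulM Y (anticomm (m ⊗ xi)) + wedge1M (compat_defect m Y) xi.
Proof.
rewrite -sigmaM_cobdryM; move: (m ⊗ xi) => {xi} u.
have -> : anticomm (lmulM Y u) = dM (bM (lmulM Y u)) + bM (dM (lmulM Y u)) by [].
rewrite bdryM_lmulM cobdryM_lmulM !(linB (@cobdryM_linear _ _ _ _ _)).
rewrite !(linN (@cobdryM_linear _ _ _ _ _)).
rewrite (linB (bdryM_linear _ Lg)) (linN (bdryM_linear _ Lg)) bdryM_lmulM bdryM_wedge2M.
(* Involutivity of g removes the bracket term of [bdryM_wedge2M]. *)
rewrite -/(delta2 delta Y) (ilb_invol Hg) (lin0 (lmulM_linear_l _)) scaler0 subr0 /=.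
case: p u => [|p] u /=.
  rewrite (lin0 (@cobdryM_linear _ _ _ _ _)) subr0 add0r !opprD !opprK addrCA -addrA.
  by rewrite addrCA -!addrA; congr (_ + _); rewrite addrCA.
rewrite cobdryM_lmulM (linD (@lmulM_linear _ _)).
set a := dM _; set b := lmulM Y _; set c := wedge2M _ _; set d := sM Y _; set e := lmulM Y _.
set f := lmulM_sigma _ _.
(* The two terms [c], delta Y wedged with the boundary of u, cancel. *)
by rewrite !opprD !opprK (AC ((1*2)*(2*2)) (2*5*(4*1*7)*(3*6))) /= subrr addr0.
Qed.

Lemma wedge1M_wedge0 t (X : 'I_0 -> g) : wedge1M t (wedge X) = to_ext1 t.
Proof.
move: t; apply: tens_lext => [||m Y].
- exact: wedge1M_linear_l.
- exact: to_ext1_linear.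
by rewrite wedge1M_tens to_ext1_tens (wedge1E Y X).
Qed.

Lemma cobdryM_wedge0 m (X : 'I_0 -> g) : dM (m ⊗ wedge X) = to_ext1 (mu m).
Proof.
by rewrite cobdryM_tensE wedge1M_wedge0 cobdry0 (lin0 (@tensM_linear_r _ _)) addr0.
Qed.

Lemma to_ext1_lmulM m Y (X : 'I_0 -> g) : to_ext1 (m ⊗ Y) = lmulM Y (m ⊗ wedge X).
Proof. by rewrite to_ext1_tens lmulM_tens (wedge1E Y X). Qed.

Lemma anticomm_wedge0 m (X : 'I_0 -> g) :
  anticomm (m ⊗ wedge X) = sigmabar act (mu m) ⊗ wedge X.
Proof.
rewrite /anticomm cobdryM_wedge0; move: (mu m); apply: tens_lext => [||m' Y].
- by move=> a u v; rewrite to_ext1_linear (bdryM_linear _ Lg).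
- by move=> a u v; rewrite sigmabar_linear tensM_linear_l.
rewrite (to_ext1_lmulM _ _ X) bdryM_lmulM /= subr0 sigmaM_tens sigma0.
by rewrite (lin0 (@tensM_linear_r _ _)) addr0 sigmabar_tens (linN (@tensM_linear_l _ _)).
Qed.

(** Since Λ^0 is a copy of the scalars, scalar multiplication gives a left inverse. *)
Lemma tens_wedge0_inj (X : 'I_0 -> g) : injective (fun m : M => m ⊗ wedge X).
Proof.
have B : bilin (fun (m : M) (xi : ext_pow g 0) => (ext_val xi : rat) *: m).
  split=> [xi|m] a u v; first by rewrite scalerDr !scalerA mulrC.
  by rewrite ext_val_linear scalerDl -scalerA.
suff e m : Defs.lift (fun (m : M) (xi : ext_pow g 0) => (ext_val xi : rat) *: m) (m ⊗ wedge X) = m.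
  by move=> m m' /= emm; rewrite -(e m) emm e.
rewrite (lift_tens _ _ B) /= /alt (big_pred1 (1%g : 'S_0)) => [|s].
  by rewrite odd_perm1 scale1r.
by apply/esym/eqP/permP => -[].
Qed.

(** * The comodule identity and the square of [d] *)

(** Normalised antisymmetrisation [r] retracts tensors onto Λ^p, and a retraction survives tensoring
    with M. *)
Lemma tmap_ext_val_inj p : injective (tmap (@id M) (@ext_val g p)).
Proof.
pose r : tpow g p -> ext_pow g p := fun t => (p`!%:R)^-1 *: mlift (@wedge g p) t.
have rL : linear r by apply: linear_scale; apply: mlift_linear; exact: wedge_multilinear.
suff K : cancel (tmap (@id M) (@ext_val g p)) (tmap id r) by exact: can_inj K.
apply: tens_lext => [||m xi].
- apply: linear_comp; first exact: tmap_linear (@linear_id M) rL.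
  exact: tmap_linear (@linear_id M) (@ext_val_linear g p).
- exact: linear_id.
rewrite (tmap_tens _ _ (@linear_id M) (@ext_val_linear g p)) (tmap_tens _ _ (@linear_id M) rL).
by congr (_ ⊗ _); exact: elift_id.
Qed.

(** Translates between [d] on M ⊗ Λ^1 and the comodule identity, which is stated in M ⊗ (g ⊗ g). *)
Lemma ext_val_cobdryM_to_ext1 t :
  tmap id (@ext_val g 2) (dM (to_ext1 t)) =
  tmap id (fun t => t - flip t) (assocr (tmap mu id t)) - tmap id (delta2 delta) t.
Proof.
have evL : linear (tmap (@id M) (@ext_val g 2)).
  exact: tmap_linear (@linear_id M) (@ext_val_linear g 2).
have d2L : linear (delta2 delta) by move=> a u v; rewrite /delta2 linearP ext_val_linear.
have d2ML : linear (tmap (@id M) (delta2 delta)) by exact: tmap_linear.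
have fL : linear (fun t : g ⊗ g => t - flip t).
  by move=> a u v; rewrite flip_linear scalerBr opprD addrACA.
have fML : linear (tmap (@id M) (fun t : g ⊗ g => t - flip t)) by exact: tmap_linear.
have muL : linear mu by exact: linearP.
have muML : linear (tmap mu (@id g)) by exact: tmap_linear.
move: t; apply: tens_lext => [||m Y].
- by move=> a u v; rewrite to_ext1_linear cobdryM_linear evL.
- by move=> a u v; rewrite muML assocr_linear fML d2ML opprD addrACA scalerBr.
rewrite !tmap_tens // (to_ext1_lmulM _ _ (fun=> 0)) cobdryM_lmulM cobdryM_wedge0.
rewrite wedge2M_tens wedgep2_0.
rewrite (linB evL) (linN evL) (tmap_tens _ _ (@linear_id M) (@ext_val_linear g 2)).
congr (_ - _); move: (mu m); apply: tens_lext => [||m' Z].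
- by move=> a u v; rewrite to_ext1_linear lmulM_linear evL opprD scalerN.
- by move=> a u v; rewrite (@tens_bilin _ _).1 assocr_linear fML.
rewrite assocr_tens !tmap_tens // to_ext1_tens lmulM_tens.
rewrite (tmap_tens _ _ (@linear_id M) (@ext_val_linear g 2)) ext_val_lmul1 flip_tens.
by rewrite -(linN (@tensM_linear_r _ _)) opprB.
Qed.

Lemma is_comoduleE : is_comodule delta mu <-> forall m, dM (to_ext1 (mu m)) = 0.
Proof.
have L : linear (tmap (@id M) (@ext_val g 2)).
  exact: tmap_linear (@linear_id M) (@ext_val_linear g 2).
split=> h m.
  by apply: tmap_ext_val_inj; rewrite ext_val_cobdryM_to_ext1 h subrr (lin0 L).
by have /esym/eqP := ext_val_cobdryM_to_ext1 (mu m); rewrite h (lin0 L) subr_eq0 => /eqP.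
Qed.

Lemma cobdryM_wedge1M t p (xi : ext_pow g p) :
  dM (wedge1M t xi) = wedgeM (dM (to_ext1 t)) xi - wedge1M t (cobdry delta xi).
Proof.
have wL : linear (fun u : M ⊗ ext_pow g 2 => wedgeM u xi) by exact: (@wedgeM_bilin g M 2 p).1.
move: t; apply: tens_lext => [||m Y].
- by move=> a u v; rewrite wedge1M_linear_l cobdryM_linear.
- move=> a u v; rewrite to_ext1_linear cobdryM_linear wL wedge1M_linear_l.
  by rewrite opprD addrACA scalerBr.
rewrite !wedge1M_tens -!lmulM_tens cobdryM_lmulM (to_ext1_lmulM _ _ (fun=> 0)) cobdryM_lmulM.
rewrite (linB wL) (linN wL) cobdryM_tensE (linD (@lmulM_linear _ _)) cobdryM_wedge0.
rewrite !wedge2M_tens wedgep2_0.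
rewrite opprD addrAC; congr (_ - _ - _); last by rewrite [RHS]wedgeM_tens.
congr (- _); move: (mu m); apply: tens_lext => [||m' Z].
- by move=> a u v; rewrite wedge1M_linear_l lmulM_linear.
- by move=> a u v; rewrite to_ext1_linear lmulM_linear wL.
rewrite wedge1M_tens to_ext1_tens !lmulM_tens [RHS]wedgeM_tens.
by rewrite wedgep_lmul (wedge1E _ (fun=> 0)) wedgep_lmul wedge0p.
Qed.

(** The mixed terms [mu m] ∧ d xi cancel because [mu m] has degree one, and coJacobi removes d (d
    xi). *)
Lemma cobdryM_cobdryM m p (xi : ext_pow g p) :
  dM (dM (m ⊗ xi)) = wedgeM (dM (to_ext1 (mu m))) xi.
Proof.
rewrite cobdryM_tensE (linD (@cobdryM_linear _ _ _ _ _)) cobdryM_wedge1M cobdryM_tensE.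
rewrite cobdry_cobdry; last exact: ilb_coJacobi Hg.
by rewrite (lin0 (@tensM_linear_r _ _)) addr0 subrK.
Qed.

Lemma cobdryM_cobdryM_eq0 : is_comodule delta mu <-> forall p (u : M ⊗ ext_pow g p), dM (dM u) = 0.
Proof.
rewrite is_comoduleE; split=> h => [p|m]; last by rewrite -(cobdryM_wedge0 _ (fun=> 0)).
apply: (@tens_lext _ _ _ _ (fun=> 0)) => [||m xi].
- by move=> a u v; rewrite !cobdryM_linear.
- exact: linear_zero.
by rewrite cobdryM_cobdryM h (bilin0l (@wedgeM_bilin g M 2 p)).
Qed.

Lemma anticomm_eq0 :
  (forall m Y, compat_defect m Y = 0) /\ (forall m, sigmabar act (mu m) = 0) <->
  forall p (u : M ⊗ ext_pow g p), anticomm u = 0.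
Proof.
split=> [[h0 h1]|h].
  (* Induction on the degree: involutivity of M starts it, and [anticomm_lmulM] with zero defect
     continues it. *)
  elim=> [|p IH]; apply: (@tens_wedge_ext _ _ _ (fun=> 0)) => [||m X]; try exact: linear_zero.
  - exact: anticomm_linear.
  - by rewrite anticomm_wedge0 h1 (lin0 (@tensM_linear_l _ _)).
  - exact: anticomm_linear.
  - rewrite wedge_fcons -lmulM_tens anticomm_lmulM IH h0.
    by rewrite (lin0 (@lmulM_linear _ _)) (lin0 (wedge1M_linear_l _)) addr0.
split=> [m Y|m]; last first.
  apply: (@tens_wedge0_inj (fun=> 0)) => /=.
  by rewrite -anticomm_wedge0 h (lin0 (@tensM_linear_l _ _)).
(* Taking xi = 1 leaves only the defect, embedded in M ⊗ Λ^1. *)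
have := anticomm_lmulM Y m (wedge (fun _ : 'I_0 => 0)).
rewrite !h (lin0 (@lmulM_linear _ _)) add0r wedge1M_wedge0 => /(congr1 (@of_ext1 g M)).
by rewrite to_ext1K (lin0 (@of_ext1_linear _ _)).
Qed.

End LieBialgebra.
End CoefficientOperators.

(* The boundary operator vanishes on M ⊗ Λ^0, so in degree 0 the anticommutator
   of d and ∂ reduces to ∂ d. *)
Theorem proposition0p0p3
  (g : lmodType rat)
  (nabla : {linear (g ⊗ g)%type -> g})
  (delta : {linear g -> ext_pow g 2})
  (Hg : involutive_lie_bialgebra nabla delta)
  (M : lmodType rat)
  (act : {linear (g ⊗ M)%type -> M})
  (HM : is_lie_module nabla act)
  (mu : {linear M -> (M ⊗ g)%type}) :
  is_involutive_bimodule nabla delta act mu <->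
  (forall (p : nat) (u : (M ⊗ ext_pow g p)%type),
     cobdryM delta mu (cobdryM delta mu u) = 0) /\
  ((forall u : (M ⊗ ext_pow g 0)%type,
      bdryM nabla act (cobdryM delta mu u) = 0) /\
   (forall (p : nat) (u : (M ⊗ ext_pow g p.+1)%type),
      cobdryM delta mu (bdryM nabla act u)
      + bdryM nabla act (cobdryM delta mu u) = 0)).
Proof.
have A0 : (forall p (u : M ⊗ ext_pow g p), anticomm nabla delta act mu u = 0) <->
    (forall u : M ⊗ ext_pow g 0, bdryM nabla act (cobdryM delta mu u) = 0) /\
    (forall p (u : M ⊗ ext_pow g p.+1), cobdryM delta mu (bdryM nabla act u)
      + bdryM nabla act (cobdryM delta mu u) = 0).
  split=> [h|[h0 h1] [|p]]; [|exact: h0|exact: h1].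
  by split=> [|p]; [exact: (h 0) | exact: (h p.+1)].
rewrite -A0 -(anticomm_eq0 _ _ Hg) -(cobdryM_cobdryM_eq0 _ Hg).
(* [compat_defect m Y = 0] unfolds to the compatibility clause of [is_bimodule], so only the
   grouping of the conjuncts differs. *)
by split=> [[[hc hd] hs]|[hc [hd hs]]].
Qed.
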